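(* Let $F$ be a field of prime characteristic $p$ and let $G,H,K$ be finite groups. Let $M$ be a $p$-permutation $(FG,FH)$-bimodule and let $N$ be a $p$-permutation $(FH,FK)$-bimodule. Assume that the vertices of every indecomposable direct summand of $M$ and $N$ lie in $\lhd_{G,H}$ and $\lhd_{H,K}$, respectively. Let $U\le G$ and $W\le K$ be $p$-subgroups, and let $\gamma\colon W\to U$ be an epimorphism. Let $\tilde\Gamma_H(U,\gamma,W)$ be a set of representatives of the $H$-orbits of $\Gamma_H(U,\gamma,W)$. Then the canonical maps $\overline m\otimes\overline n\mapsto\overline{m\otimes n}$ induce an isomorphism $$\bigoplus_{(\alpha,V,\beta)\in\tilde\Gamma_H(U,\gamma,W)}M(\lhd(U,\alpha,V))\otimes_{FC_H(V)}N(\lhd(V,\beta,W))\ \xrightarrow{\ \sim\ }\ (M\otimes_{FH}N)(\lhd(U,\gamma,W))$$ of $(FC_G(U),FC_K(W))$-bimodules.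
   Context: All modules over group algebras have finite $F$-dimension. $(FG,FH)$-bimodules are identified with left $F[G\times H]$-modules via $(g,h)m=gmh^{-1}$. An $FG$-module is a $p$-permutation module if it is isomorphic to a direct summand of a permutation module $FX$ for a finite $G$-set $X$; an $(FG,FH)$-bimodule is a $p$-permutation bimodule if it is so as an $F[G\times H]$-module. A vertex of an indecomposable $FG$-module $M$ is a subgroup $P\le G$ minimal with the property that $M$ is isomorphic to a direct summand of $FG\otimes_{FP}M$; vertices of indecomposable $(FG,FH)$-bimodules are subgroups of $G\times H$. For groups $U,V$, $E(U,V)$ is the set of epimorphisms $V\to U$. For $U\le G$, $V\le H$, $\alpha\in E(U,V)$, put $\lhd(U,\alpha,V)=\{(\alpha(v),v)\mid v\in V\}\le G\times H$. $\lhd_{G,H}$ is the set of all such subgroups of $G\times H$ (equivalently, the subgroups $L\le G\times H$ with $\{g\in G\mid (g,1)\in L\}=1$). For $U\le G$, $W\le K$, $\gamma\in E(U,W)$, $\Gamma_H(U,\gamma,W)$ is the set of triples $(\alpha,V,\beta)$ with $V\le H$, $\alpha\in E(U,V)$, $\beta\in E(V,W)$, $\alpha\beta=\gamma$; $H$ acts on it by $h(\alpha,V,\beta)=(\alpha c_h^{-1},hVh^{-1},c_h\beta)$, where $c_h(x)=hxh^{-1}$. For an $FG$-module $M$ and a $p$-subgroup $P\le G$, the Brauer construction is $M(P)=M^P/\sum_{Q<P}\mathrm{tr}_Q^P(M^Q)$, where $\mathrm{tr}_Q^P\colon M^Q\to M^P$, $m\mapsto\sum_{xQ\in P/Q}xm$;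 it is an $FN_G(P)$-module, and $\overline m$ denotes the class of $m\in M^P$. Since $C_G(U)\times C_H(V)\le N_{G\times H}(\lhd(U,\alpha,V))$, $M(\lhd(U,\alpha,V))$ is an $(FC_G(U),FC_H(V))$-bimodule; similarly for the others. If $\alpha\beta=\gamma$, the map $(m,n)\mapsto m\otimes n$ from $M^{\lhd(U,\alpha,V)}\times N^{\lhd(V,\beta,W)}$ to $(M\otimes_{FH}N)^{\lhd(U,\gamma,W)}$ induces a well-defined bimodule homomorphism $M(\lhd(U,\alpha,V))\otimes_{FC_H(V)}N(\lhd(V,\beta,W))\to(M\otimes_{FH}N)(\lhd(U,\gamma,W))$, $\overline m\otimes\overline n\mapsto\overline{m\otimes n}$; these are the canonical maps. *)

(* Defs.v *)
From HB Require Import structures.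
From mathcomp Require Import all_boot all_order all_algebra all_fingroup.

Set Implicit Arguments.
Unset Strict Implicit.
Unset Printing Implicit Defensive.

Import GroupScope GRing.Theory.
Import VectorInternalTheory.
Local Open Scope ring_scope.

(* A / (A :&: B) is modelled by a complement of A :&: B in A; sqpi is the
   class map, which is meaningful on A only (see sqpi_eq0 and sqpi_repr). *)
Section Subquotient.
Variables (F : fieldType) (V : vectType F).
Implicit Types A B : {vspace V}.

Definition subquot A B : vectType F := subvs_of (A :\: B)%VS.

Definition sqpi A B : 'Hom(V, subquot A B) :=
  (linfun (@vsproj _ _ (A :\: B)%VS) \o addv_pi1 A B)%VF.

Definition sqrepr A B : 'Hom(subquot A B, V) := linfun vsval.

Lemma sqreprP A B (x : subquot A B) : sqrepr A B x \in A.
Proof. by rewrite lfunE /=; apply: subvP (diffvSl A B) _ (subvsP x). Qed.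

Lemma sqpiE A B (v : V) : sqrepr A B (sqpi A B v) = addv_pi1 A B v.
Proof. by rewrite lfunE /= comp_lfunE lfunE /= vsprojK //; exact: memv_pi. Qed.

Lemma sqpi_repr A B (x : subquot A B) : sqpi A B (sqrepr A B x) = x.
Proof.
apply: val_inj; have /= := sqpiE A B (sqrepr A B x); rewrite !lfunE /= => ->.
by rewrite /addv_pi1 daddv_pi_id ?subvsP // capv_diff.
Qed.

Lemma sqpi_eq0 A B (v : V) : v \in A -> (sqpi A B v == 0) = (v \in B).
Proof.
move=> Av; have AvB: v \in (A + B)%VS by apply: subvP (addvSl A B) _ Av.
have eAB := addv_pi1_pi2 AvB.
apply/eqP/idP => [v0 | Bv]; first by rewrite -eAB -sqpiE v0 linear0 add0r memv_pi2.
have /eqP := eAB; rewrite addv_pi2_id // -subr_eq0 addrK -sqpiE => /eqP v0.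
by rewrite -[LHS]sqpi_repr v0 linear0.
Qed.

Lemma sqpi_reprB A B (v : V) : v \in A -> sqrepr A B (sqpi A B v) - v \in B.
Proof.
move=> Av; rewrite -(@sqpi_eq0 A) ?rpredB ?sqreprP //.
by rewrite linearB /= sqpi_repr subrr.
Qed.

End Subquotient.

Section SubquotientMap.
Variables (F : fieldType) (V V' : vectType F).
Variables (A B : {vspace V}) (A' B' : {vspace V'}).

Definition sqmap (f : 'Hom(V, V')) : 'Hom(subquot A B, subquot A' B') :=
  (sqpi A' B' \o f \o sqrepr A B)%VF.

Lemma sqmap_repr f x : sqmap f x = sqpi A' B' (f (sqrepr A B x)).
Proof.
by rewrite [LHS]comp_lfunE; rewrite [(sqpi A' B' \o f)%VF _]comp_lfunE.
Qed.

Lemma sqmapE f v : (f @: A <= A')%VS -> (f @: B <= B')%VS -> v \in A ->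
  sqmap f (sqpi A B v) = sqpi A' B' (f v).
Proof.
move=> sAA sBB Av; rewrite sqmap_repr; apply/eqP; rewrite -subr_eq0 -!linearB /=.
have fAA: {in A, forall u, f u \in A'}.
  by move=> u Au; apply: subvP sAA _ (memv_img _ Au).
rewrite sqpi_eq0; last by rewrite fAA // rpredB // sqreprP.
by apply: subvP sBB _ (memv_img _ (sqpi_reprB _ Av)).
Qed.

End SubquotientMap.

(* mact is only meaningful on G; its values outside G are ignored by all the
   definitions below. *)
Record gmodule (F : fieldType) (gT : finGroupType) (G : {group gT}) := GModule {
  mcarrier :> vectType F;
  mact : gT -> 'End(mcarrier);
  mact1 : mact 1%g = \1%VF;
  mactM : {in G &, forall g h, mact (g * h)%g = (mact g \o mact h)%VF}
}.

Notation bimodule F G H := (gmodule F (setX_group G H)).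

Section Modules.
Variables (F : fieldType) (gT : finGroupType) (G : {group gT}).
Implicit Types L M N : gmodule F G.

Definition gmod_hom M N (f : 'Hom(M, N)) : Prop :=
  {in G, forall g, forall m, f (mact M g m) = mact N g (f m)}.

Definition gstable M (A : {vspace M}) : Prop :=
  {in G, forall g, (mact M g @: A <= A)%VS}.

Definition direct_summand M (A : {vspace M}) : Prop :=
  gstable A /\ exists B : {vspace M},
    [/\ gstable B, (A + B = fullv)%VS & (A :&: B = 0)%VS].

Definition isom_to_summand L M : Prop :=
  exists f : 'Hom(L, M),
    [/\ gmod_hom f, lker f = 0%VS & direct_summand (limg f)].

Definition indecomposable M : Prop :=
  (fullv : {vspace M}) <> 0%VS /\
  forall A B : {vspace M}, gstable A -> gstable B ->
    (A + B = fullv)%VS -> (A :&: B = 0)%VS -> A = 0%VS \/ B = 0%VS.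

Section Restriction.
Variables (P : {group gT}) (sPG : P \subset G) (M : gmodule F G).

Fact gres_mactM :
  {in P &, forall g h, mact M (g * h)%g = (mact M g \o mact M h)%VF}.
Proof. by move=> g h /(subsetP sPG) Gg /(subsetP sPG) Gh; apply: mactM. Qed.

Definition gres : gmodule F P := GModule (mact1 M) gres_mactM.

End Restriction.

(* MathComp actions are right actions: to is the left G-set X for
   g . x = to x g^-1, so that the point mass at x is sent by g to the point
   mass at g . x. *)
Section PermutationModule.
Variables (X : finType) (to : action G X).

Definition perm_fun (g : gT) (f : {ffun X -> F^o}) : {ffun X -> F^o} :=
  [ffun x => f (to x g)].

Fact perm_fun_linear g : linear (perm_fun g).
Proof. by move=> c f f'; apply/ffunP=> x; rewrite !ffunE. Qed.
HB.instance Definition _ g :=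
  GRing.isLinear.Build F {ffun X -> F^o} {ffun X -> F^o} _ (perm_fun g)
    (perm_fun_linear g).

Fact perm_mact1 : linfun (perm_fun 1%g) = \1%VF.
Proof. by apply/lfunP=> f; rewrite !lfunE; apply/ffunP=> x; rewrite ffunE act1. Qed.

Fact perm_mactM : {in G &, forall g h,
  linfun (perm_fun (g * h)%g) = (linfun (perm_fun g) \o linfun (perm_fun h))%VF}.
Proof.
move=> g h Gg Gh; apply/lfunP=> f; rewrite comp_lfunE !lfunE /=.
by apply/ffunP=> x; rewrite !ffunE actMin.
Qed.

Definition perm_gmod : gmodule F G := GModule perm_mact1 perm_mactM.

End PermutationModule.

Definition p_permutation M : Prop :=
  exists (X : finType) (to : action G X), isom_to_summand M (perm_gmod to).

End Modules.

(* The group algebra FG as an (FG,FG)-bimodule: (g, h) maps the point mass at y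
   to the point mass at g y h^-1. *)
Section GroupAlgebra.
Variables (F : fieldType) (gT : finGroupType) (G : {group gT}).

Definition galg_fun (x : gT * gT) (f : {ffun [subg G] -> F^o}) :
    {ffun [subg G] -> F^o} :=
  [ffun y => f (subg G (x.1^-1 * sgval y * x.2)%g)].

Fact galg_fun_linear x : linear (galg_fun x).
Proof. by move=> c f f'; apply/ffunP=> y; rewrite !ffunE. Qed.
HB.instance Definition _ x :=
  GRing.isLinear.Build F {ffun [subg G] -> F^o} {ffun [subg G] -> F^o} _
    (galg_fun x) (galg_fun_linear x).

Fact galg_mact1 : linfun (galg_fun 1%g) = \1%VF.
Proof.
apply/lfunP=> f; rewrite !lfunE; apply/ffunP=> y; rewrite ffunE /=.
by rewrite invg1 mul1g mulg1 sgvalK.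
Qed.

Fact galg_mactM : {in setX_group G G &, forall x y,
  linfun (galg_fun (x * y)%g) = (linfun (galg_fun x) \o linfun (galg_fun y))%VF}.
Proof.
move=> [x1 x2] [y1 y2] /setXP[Gx1 Gx2] /setXP[Gy1 Gy2].
apply/lfunP=> f; rewrite comp_lfunE !lfunE /=; apply/ffunP=> z.
rewrite !ffunE subgK ?groupM ?groupV ?subgP //=.
by rewrite invMg !mulgA.
Qed.

Definition galg : bimodule F G G := GModule galg_mact1 galg_mactM.

End GroupAlgebra.

(* The tensor product over F of M and N is modelled in coordinates by matrices,
   a pure tensor being the outer product of the coordinate vectors. *)
Section TensorF.
Variables (F : fieldType).
Implicit Types M N : vectType F.

Definition tensF M N : vectType F := 'M[F]_(dim M, dim N).

Definition pureF M N (m : M) (n : N) : tensF M N := (v2r m)^T *m v2r n.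

Definition tmapF M N M' N' (f : 'Hom(M, M')) (g : 'Hom(N, N')) :
    'Hom(tensF M N, tensF M' N') :=
  linfun (mulmxr (f2mx g) \o mulmx (f2mx f)^T).

Lemma pureF_linearl M N (n : N) : linear (fun m : M => pureF m n).
Proof. by move=> c m m'; rewrite /pureF !linearP /= mulmxDl -scalemxAl. Qed.

Lemma pureF_linearr M N (m : M) : linear (fun n : N => pureF m n).
Proof. by move=> c n n'; rewrite /pureF !linearP. Qed.

Lemma tmapF_pure M N M' N' (f : 'Hom(M, M')) (g : 'Hom(N, N')) m n :
  tmapF f g (pureF m n) = pureF (f m) (g n).
Proof.
have v2rE V W (h : 'Hom(V, W)) u : v2r (h u) = v2r u *m f2mx h.
  by rewrite unlock /= r2vK.
by rewrite lfunE /= /pureF !v2rE trmx_mul !mulmxA.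
Qed.

Lemma tensF_span M N (x : tensF M N) :
  exists c : 'I_(dim M) -> 'I_(dim N) -> F,
    x = \sum_i \sum_j c i j *: pureF (r2v (delta_mx 0 i)) (r2v (delta_mx 0 j)).
Proof.
exists x; rewrite [LHS]matrix_sum_delta; apply: eq_bigr => i _.
apply: eq_bigr => j _; rewrite /pureF !r2vK trmx_delta; congr (_ *: _).
by rewrite mul_delta_mx.
Qed.

Lemma tensF_eq M N M' N' (f g : 'Hom(tensF M N, tensF M' N')) :
  (forall m n, f (pureF m n) = g (pureF m n)) -> f = g.
Proof.
move=> fg; apply/lfunP=> x; have [c ->] := tensF_span x.
rewrite !linear_sum; apply: eq_bigr => i _; rewrite !linear_sum.
by apply: eq_bigr => j _; rewrite !linearZ /= fg.
Qed.

Lemma tmapF_comp M N (f f' : 'End(M)) (g g' : 'End(N)) :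
  (tmapF f g \o tmapF f' g' = tmapF (f \o f') (g \o g'))%VF.
Proof. by apply: tensF_eq => m n; rewrite comp_lfunE !tmapF_pure !comp_lfunE. Qed.

Lemma tmapF1 M N : tmapF \1%VF \1%VF = \1%VF :> 'End(tensF M N).
Proof. by apply: tensF_eq => m n; rewrite tmapF_pure !id_lfunE. Qed.

End TensorF.

(* The tensor product over FH, for a right action r and a left action l of H:
   as pure tensors span, the relations m h (x) n - m (x) h n span
   tensor_rel H r l. *)
Section TensorH.
Variables (F : fieldType) (hT : finGroupType) (M N : vectType F).
Variables (H : {group hT}) (r : hT -> 'End(M)) (l : hT -> 'End(N)).

Definition tensor_rel : {vspace tensF M N} :=
  (\sum_(h in H) limg (tmapF (r h) \1 - tmapF \1 (l h)))%VS.

Definition tensor : vectType F := subquot fullv tensor_rel.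

Definition tpure (m : M) (n : N) : tensor := sqpi fullv tensor_rel (pureF m n).

Definition tmap (f : 'End(M)) (g : 'End(N)) : 'End(tensor) :=
  sqmap fullv tensor_rel fullv tensor_rel (tmapF f g).

Lemma tpure_balanced h m n : h \in H -> tpure (r h m) n = tpure m (l h n).
Proof.
move=> Hh; apply/eqP; rewrite -subr_eq0 -linearB /= sqpi_eq0 ?memvf //.
apply: subvP (sumv_sup h Hh (subvv _)) _ _.
have -> : pureF (r h m) n - pureF m (l h n) =
          (tmapF (r h) \1 - tmapF \1 (l h))%VF (pureF m n).
  by rewrite add_lfunE opp_lfunE !tmapF_pure !id_lfunE.
exact: memv_img (memvf _).
Qed.

Definition balanced_map (f : 'End(M)) (g : 'End(N)) : Prop :=
  {in H, forall h, (f \o r h = r h \o f)%VF /\ (g \o l h = l h \o g)%VF}.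

Lemma tmapF_rel f g : balanced_map f g ->
  (tmapF f g @: tensor_rel <= tensor_rel)%VS.
Proof.
move=> fgH; rewrite /tensor_rel limg_sum; apply/subv_sumP => h Hh.
have [fr gl] := fgH h Hh.
apply: subv_trans (sumv_sup h Hh (subvv _)); rewrite -limg_comp.
have -> : (tmapF f g \o (tmapF (r h) \1 - tmapF \1 (l h)) =
           (tmapF (r h) \1 - tmapF \1 (l h)) \o tmapF f g)%VF.
  rewrite comp_lfunDr comp_lfunDl comp_lfunNr comp_lfunNl !tmapF_comp.
  by rewrite !comp_lfun1l !comp_lfun1r fr gl.
by rewrite limg_comp limgS ?subvf.
Qed.

Lemma tmap_pi f g x : balanced_map f g ->
  tmap f g (sqpi fullv tensor_rel x) = sqpi fullv tensor_rel (tmapF f g x).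
Proof. by move=> fgH; apply: sqmapE; rewrite ?subvf ?memvf ?tmapF_rel. Qed.

Lemma tmap_pure f g m n : balanced_map f g ->
  tmap f g (tpure m n) = tpure (f m) (g n).
Proof. by move=> fgH; rewrite tmap_pi // tmapF_pure. Qed.

Lemma tmap1 : tmap \1 \1 = \1%VF.
Proof.
by apply/lfunP=> x; rewrite sqmap_repr tmapF1 !id_lfunE sqpi_repr.
Qed.

Lemma tmap_comp f f' g g' : balanced_map f g ->
  tmap (f \o f') (g \o g') = (tmap f g \o tmap f' g')%VF.
Proof.
move=> fgH; apply/lfunP=> x; rewrite comp_lfunE.
rewrite [tmap f' g' x]sqmap_repr tmap_pi // [LHS]sqmap_repr.
by rewrite -tmapF_comp comp_lfunE.
Qed.

End TensorH.

Section BimoduleActions.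
Variables (F : fieldType) (gT hT : finGroupType).
Variables (G : {group gT}) (H : {group hT}) (M : bimodule F G H).

Definition lmact (g : gT) : 'End(M) := mact M (g, 1%g).
Definition rmact (h : hT) : 'End(M) := mact M (1%g, h^-1%g).

Lemma lmact1 : lmact 1 = \1%VF. Proof. exact: mact1. Qed.

Lemma lmactM : {in G &, forall g g', lmact (g * g') = (lmact g \o lmact g')%VF}.
Proof.
move=> g g' Gg Gg'; rewrite -mactM ?inE /= ?Gg ?Gg' ?group1 //.
by rewrite /lmact; congr (mact M (_, _)); rewrite mulg1.
Qed.

Lemma lrmactC : {in G & H, forall g h, (lmact g \o rmact h = rmact h \o lmact g)%VF}.
Proof.
move=> g h Gg Hh; rewrite -!mactM ?inE /= ?groupV ?group1 ?Gg ?Hh //.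
by congr (mact M (_, _)); rewrite ?mulg1 ?mul1g.
Qed.

End BimoduleActions.

Section TensorBimodule.
Variables (F : fieldType) (gT hT kT : finGroupType).
Variables (G : {group gT}) (H : {group hT}) (K : {group kT}).
Variables (M : bimodule F G H) (N : bimodule F H K).

Definition btens_car : vectType F := tensor H (rmact M) (lmact N).

(* (g,k) (m (x) n) = g m (x) n k^-1 *)
Definition btens_act (x : gT * kT) : 'End(btens_car) :=
  tmap H (rmact M) (lmact N) (lmact M x.1) (rmact N x.2^-1).

Fact btens_mact1 : btens_act 1%g = \1%VF.
Proof. by rewrite /btens_act /rmact !invg1 lmact1 mact1 tmap1. Qed.

Fact btens_balanced : {in setX_group G K, forall x,
  balanced_map H (rmact M) (lmact N) (lmact M x.1) (rmact N x.2^-1)}.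
Proof.
move=> [x1 x2] /setXP[Gx Kx] h Hh; split; first exact: lrmactC.
by rewrite -lrmactC ?groupV.
Qed.

Fact btens_mactM : {in setX_group G K &, forall x y,
  btens_act (x * y)%g = (btens_act x \o btens_act y)%VF}.
Proof.
move=> [x1 x2] [y1 y2] Px Py; rewrite -tmap_comp; last exact: btens_balanced Px.
case/setXP: Px Py => Gx Kx /setXP[Gy Ky].
rewrite /btens_act lmactM // /rmact -mactM ?inE /= ?invgK ?group1 //.
by congr (tmap _ _ _ _ (mact N (_, _))); rewrite mulg1.
Qed.

Definition btens : bimodule F G K := GModule btens_mact1 btens_mactM.

Definition bpure (m : M) (n : N) : btens := tpure H (rmact M) (lmact N) m n.

End TensorBimodule.

Section Induction.
Variables (F : fieldType) (gT : finGroupType) (G P : {group gT}).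
Variables (sPG : P \subset G) (M : gmodule F P).

Definition ind_car : vectType F := tensor P (rmact (galg F G)) (mact M).

Definition ind_act (g : gT) : 'End(ind_car) :=
  tmap P (rmact (galg F G)) (mact M) (lmact (galg F G) g) \1.

Fact ind_mact1 : ind_act 1%g = \1%VF.
Proof. by rewrite /ind_act lmact1 tmap1. Qed.

Fact ind_mactM : {in G &, forall g h, ind_act (g * h)%g = (ind_act g \o ind_act h)%VF}.
Proof.
move=> g h Gg Gh; rewrite -tmap_comp ?comp_lfun1l ?/ind_act ?lmactM //.
move=> x Px; rewrite comp_lfun1l comp_lfun1r; split=> //.
by rewrite lrmactC // (subsetP sPG).
Qed.

Definition gind : gmodule F G := GModule ind_mact1 ind_mactM.

End Induction.

Section Vertex.
Variables (F : fieldType) (gT : finGroupType) (G : {group gT}).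
Variable M : gmodule F G.

Definition rel_projective (P : {group gT}) : Prop :=
  exists sPG : P \subset G, isom_to_summand M (gind sPG (gres sPG M)).

Definition vertex (P : {group gT}) : Prop :=
  rel_projective P /\
  forall Q : {group gT}, Q \proper P -> ~ rel_projective Q.

End Vertex.

Section Brauer.
Variables (F : fieldType) (gT : finGroupType) (G : {group gT}).
Variable M : gmodule F G.

Definition fixv (P : {group gT}) : {vspace M} :=
  (\bigcap_(g in P) fixedSpace (mact M g))%VS.

Lemma fixvP (P : {group gT}) m :
  reflect {in P, forall g, mact M g m = m} (m \in fixv P).
Proof.
apply: (iffP idP) => [|fixm].
  rewrite memvE => /subv_bigcapP fixm g Pg.
  by apply/fixedSpaceP; rewrite memvE fixm.
rewrite memvE; apply/subv_bigcapP => g Pg.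
by rewrite -memvE; apply/fixedSpaceP/fixm.
Qed.

(* restricts to the relative trace map from M^Q to M^P *)
Definition trace (Q P : {group gT}) : 'End(M) :=
  \sum_(C in lcosets Q P) mact M (repr C).

Definition traces (P : {group gT}) : {vspace M} :=
  (\sum_(Q : {group gT} | Q \proper P) trace Q P @: fixv Q)%VS.

Section Quotient.
Variables (P : {group gT}) (sPG : P \subset G).

Definition brauer_car : vectType F := subquot (fixv P) (traces P).

Definition brcls (m : M) : brauer_car := sqpi (fixv P) (traces P) m.

Definition brauer_act (g : gT) : 'End(brauer_car) :=
  sqmap (fixv P) (traces P) (fixv P) (traces P) (mact M g).

Lemma mactMv g h m : g \in G -> h \in G ->
  mact M g (mact M h m) = mact M (g * h)%g m.
Proof. by move=> Gg Gh; rewrite mactM // comp_lfunE. Qed.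

Lemma fixv_conj (Q : {group gT}) g m : Q \subset G -> g \in G ->
  m \in fixv Q -> mact M g m \in fixv (Q :^ g^-1)%G.
Proof.
move=> sQG Gg /fixvP fixm; apply/fixvP=> _ /imsetP[x Qx ->].
have Gx := subsetP sQG x Qx.
rewrite mactMv ?groupJ ?groupV // conjgE invgK -!mulgA mulVg mulg1.
by rewrite -mactMv ?(fixm x).
Qed.

Lemma trace_eq (Q R : {group gT}) (f : {set gT} -> gT) m : Q \subset R -> R \subset G ->
  m \in fixv Q -> {in lcosets Q R, forall C, f C \in C} ->
  trace Q R m = \sum_(C in lcosets Q R) mact M (f C) m.
Proof.
move=> sQR sRG /fixvP fixm fC; rewrite sum_lfunE; apply: eq_bigr => C QRC.
have:= fC C QRC; case/lcosetsP: QRC => x Rx -> /lcosetP[y Qy ->].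
have: (repr (x *: Q) \in x *: Q)%g by apply: mem_repr (lcoset_refl Q x).
case/lcosetP=> z Qz ->; have sQG := subset_trans sQR sRG.
have [[Gx Gy] Gz] := (subsetP sRG x Rx, subsetP sQG y Qy, subsetP sQG z Qz).
by rewrite -(mactMv _ Gx Gy) -(mactMv _ Gx Gz) (fixm y Qy) (fixm z Qz).
Qed.

Lemma trace_conj (Q : {group gT}) g m : Q \subset P -> g \in 'N_G(P) ->
  m \in fixv Q -> mact M g (trace Q P m) = trace (Q :^ g^-1)%G P (mact M g m).
Proof.
move=> sQP /setIP[Gg nPg] fixm; have sQG := subset_trans sQP sPG.
have nPV : g^-1%g \in 'N(P) by rewrite groupV.
have sJP : (Q :^ g^-1)%G \subset P by rewrite -(normP nPV) conjSg.
have injJ : injective (fun C : {set gT} => C :^ g) by apply: conjsg_inj.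
pose f (C : {set gT}) := (repr (C :^ g) ^ g^-1)%g.
have QPJ C : (C \in lcosets (Q :^ g^-1)%G P) = (C :^ g \in lcosets Q P).
  apply/lcosetsP/lcosetsP => [[x Px ->] | [x Px eC]].
    exists (x ^ g)%g; first by rewrite memJ_norm.
    by rewrite /= conjsMg conjsgKV conjg_set1.
  exists (x ^ g^-1)%g; first by rewrite memJ_norm.
  by rewrite -[C](conjsgK g) eC conjsMg conjg_set1.
rewrite (@trace_eq (Q :^ g^-1)%G P f) ?(fixv_conj sQG) //; last first.
  move=> C; rewrite QPJ => /lcosetsP[x Px eC].
  rewrite /f -mem_conjg eC.
  exact: mem_repr (lcoset_refl Q x).
rewrite sum_lfunE linear_sum (reindex_inj injJ) /=.
apply: eq_big => [C | C]; first by rewrite QPJ.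
move=> /lcosetsP[x Px eC].
have Py : repr (C :^ g) \in P.
  have: (repr (x *: Q) \in x *: Q)%g by apply: mem_repr (lcoset_refl Q x).
  by rewrite eC => /lcosetP[z Qz ->]; rewrite groupM // (subsetP sQP).
have Gy := subsetP sPG _ Py; have GJ: f C \in G by rewrite groupJ ?groupV.
rewrite !mactMv //; congr (mact M _ m).
by rewrite /f conjgE invgK -!mulgA mulVg mulg1.
Qed.

Lemma fixv_norm g : g \in 'N_G(P) -> (mact M g @: fixv P <= fixv P)%VS.
Proof.
move=> Ng; case/setIP: (Ng) => Gg nPg; apply/subvP=> _ /memv_imgP[m fm ->].
have:= fixv_conj sPG Gg fm; congr (_ \in fixv _).
by apply: val_inj; rewrite /= (normP _) ?groupV.
Qed.

Lemma traces_norm g : g \in 'N_G(P) -> (mact M g @: traces P <= traces P)%VS.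
Proof.
move=> Ng; case/setIP: (Ng) => Gg nPg.
rewrite /traces limg_sum; apply/subv_sumP => Q prQP.
have sQP := proper_sub prQP.
have nPV : g^-1%g \in 'N(P) by rewrite groupV.
apply: subv_trans (sumv_sup (Q :^ g^-1)%G _ (subvv _)); last first.
  by rewrite -(normP nPV) properJ.
rewrite -limg_comp; apply/subvP=> _ /memv_imgP[m fm ->].
rewrite comp_lfunE trace_conj // memv_img // fixv_conj //.
exact: subset_trans sQP sPG.
Qed.

Fact brauer_mact1 : brauer_act 1%g = \1%VF.
Proof.
by apply/lfunP=> x; rewrite sqmap_repr mact1 !id_lfunE sqpi_repr.
Qed.

Fact brauer_mactM : {in 'N_G(P)%G &, forall g h,
  brauer_act (g * h)%g = (brauer_act g \o brauer_act h)%VF}.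
Proof.
move=> g h Ng Nh; apply/lfunP=> x.
rewrite [RHS]comp_lfunE [brauer_act h x]sqmap_repr [LHS]sqmap_repr.
rewrite sqmapE ?fixv_norm ?traces_norm //; last first.
  by apply: subvP (fixv_norm Nh) _ (memv_img _ (sqreprP _)).
by case/setIP: Ng Nh => Gg _ /setIP[Gh _]; rewrite mactMv.
Qed.

Definition brauer : gmodule F 'N_G(P)%G := GModule brauer_mact1 brauer_mactM.

End Quotient.
End Brauer.

(* An element of E(U,V) is represented by the function that extends it by 1
   outside V, which makes E(U,V) a finite type. *)
Section Epi.
Variables (gT hT : finGroupType).

Definition is_epi (U : {group gT}) (V : {group hT}) (f : {ffun hT -> gT}) :=
  [&& morphic V f, [forall x, (x \notin V) ==> (f x == 1%g)] & f @: V == U].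

Definition epi (U : {group gT}) (V : {group hT}) :=
  {f : {ffun hT -> gT} | is_epi U V f}.

Definition epi_fun U V (a : epi U V) : hT -> gT := val a.
Coercion epi_fun : epi >-> Funclass.

Section Lhd.
Variables (U : {group gT}) (V : {group hT}) (a : epi U V).

Lemma epiM : {in V &, forall v w, a (v * w)%g = (a v * a w)%g}.
Proof. by case/and3P: (valP a) => /morphicP. Qed.

Lemma epi1 : a 1%g = 1%g.
Proof. by apply: (mulgI (a 1%g)); rewrite -epiM ?mulg1. Qed.

Lemma epi_im v : v \in V -> a v \in U.
Proof. by case/and3P: (valP a) => _ _ /eqP aV Vv; rewrite -aV imset_f. Qed.

Definition lhd_set : {set gT * hT} := [set (a v, v) | v in V].

Fact lhd_group_set : group_set lhd_set.
Proof.
apply/group_setP; split; first by apply/imsetP; exists 1%g; rewrite ?epi1.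
move=> _ _ /imsetP[v Vv ->] /imsetP[w Vw ->].
by apply/imsetP; exists (v * w)%g; rewrite ?groupM // epiM.
Qed.

Definition lhd : {group gT * hT} := Group lhd_group_set.

Lemma lhd_sub (G : {group gT}) (H : {group hT}) :
  U \subset G -> V \subset H -> lhd \subset setX_group G H.
Proof.
move=> sUG sVH; apply/subsetP=> _ /imsetP[v Vv ->].
by rewrite inE /= (subsetP sUG) ?(subsetP sVH) ?epi_im.
Qed.

Lemma cent_lhd_norm (G : {group gT}) (H : {group hT}) :
  setX_group 'C_G(U)%G 'C_H(V)%G \subset 'N_(setX_group G H)(lhd)%G.
Proof.
apply/subsetP=> -[c d] /setXP[/setIP[Gc cUc] /setIP[Hd cVd]].
rewrite !inE /= Gc Hd /=; apply/subsetP=> _ /imsetP[_ /imsetP[v Vv ->] ->].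
apply/imsetP; exists v => //; congr (_, _).
  by rewrite -[RHS](mulKg c) (centP cUc _ (epi_im Vv)).
by rewrite -[RHS](mulKg d) (centP cVd _ Vv).
Qed.

End Lhd.

Definition in_lhd (G : {group gT}) (H : {group hT}) (L : {group gT * hT}) : Prop :=
  exists (U : {group gT}) (V : {group hT}) (a : epi U V),
    [/\ U \subset G, V \subset H & L = lhd a].

End Epi.

Definition brauer_lhd (F : fieldType) (gT hT : finGroupType)
    (G : {group gT}) (H : {group hT}) (M : bimodule F G H)
    (U : {group gT}) (V : {group hT}) (a : epi U V)
    (sUG : U \subset G) (sVH : V \subset H) : bimodule F 'C_G(U)%G 'C_H(V)%G :=
  gres (cent_lhd_norm a G H) (brauer M (lhd_sub a sUG sVH)).

Definition brauer_lhd_cls (F : fieldType) (gT hT : finGroupType)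
    (G : {group gT}) (H : {group hT}) (M : bimodule F G H)
    (U : {group gT}) (V : {group hT}) (a : epi U V)
    (sUG : U \subset G) (sVH : V \subset H) (m : M) : brauer_lhd M a sUG sVH :=
  brcls (lhd a) m.

Section Gamma.
Variables (gT hT kT : finGroupType) (H : {group hT}).
Variables (U : {group gT}) (W : {group kT}) (gamma : epi U W).

Notation pretriple := ({ffun hT -> gT} * {group hT} * {ffun kT -> hT})%type.

Definition is_Gamma (t : pretriple) : bool :=
  [&& t.1.2 \subset H, is_epi U t.1.2 t.1.1, is_epi t.1.2 W t.2
    & [forall w in W, t.1.1 (t.2 w) == gamma w]].

Definition Gamma := {t : pretriple | is_Gamma t}.

Section Projections.
Variable t : Gamma.

Definition GV : {group hT} := (val t).1.2.

Fact Galpha_subproof : is_epi U GV (val t).1.1.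
Proof. by case/and4P: (valP t). Qed.
Definition Galpha : epi U GV := Sub (val t).1.1 Galpha_subproof.

Fact Gbeta_subproof : is_epi GV W (val t).2.
Proof. by case/and4P: (valP t). Qed.
Definition Gbeta : epi GV W := Sub (val t).2 Gbeta_subproof.

Lemma GV_sub : GV \subset H.
Proof. by case/and4P: (valP t). Qed.

End Projections.

(* h (a, V, b) = (a c_h^-1, h V h^-1, c_h b), where c_h x = h x h^-1 is
   x ^ h^-1 in MathComp. *)
Definition Gact (h : hT) (t : pretriple) : pretriple :=
  ([ffun x => t.1.1 (x ^ h)%g], (t.1.2 :^ h^-1)%G, [ffun w => (t.2 w ^ h^-1)%g]).

Lemma Gact_stable h t : h \in H -> is_Gamma t -> is_Gamma (Gact h t).
Proof.
case: t => [[a V] b] Hh /and4P[/= sVH /and3P[aM a1 /eqP aV]].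
case/and3P=> bM b1 /eqP bW /'forall_implyP abg.
have nHh : h^-1%g \in 'N(H) by rewrite groupV (subsetP (normG H)).
have VJ x : (x \in V :^ h^-1) = (x ^ h \in V)%g by rewrite mem_conjgV.
apply/and4P; split=> /=.
- by rewrite -(normP nHh) conjSg.
- apply/and3P; split.
  + apply/morphicP=> x y; rewrite !VJ => Vx Vy.
    by rewrite !ffunE conjMg (morphicP aM).
  + apply/forallP=> x; apply/implyP; rewrite VJ ffunE => Vx.
    by have /forallP/(_ (x ^ h)%g)/implyP-> := a1.
  + apply/eqP; rewrite -aV; apply/setP=> u.
    apply/imsetP/imsetP=> -[x Vx ->].
      by exists (x ^ h)%g; rewrite -?VJ ?ffunE.
    by exists (x ^ h^-1)%g; rewrite ?memJ_conjg ?ffunE ?conjgKV.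
- apply/and3P; split.
  + by apply/morphicP=> x y Wx Wy; rewrite !ffunE (morphicP bM) // conjMg.
  + apply/forallP=> x; apply/implyP=> Wx; rewrite ffunE.
    by have /forallP/(_ x)/implyP/(_ Wx)/eqP-> := b1; rewrite conj1g.
  + apply/eqP/setP=> v; rewrite /= -bW; apply/imsetP/imsetP.
      by case=> w Ww ->; exists (b w); rewrite ?imset_f ?ffunE.
    by case=> _ /imsetP[w Ww ->] ->; exists w; rewrite ?ffunE.
- by apply/'forall_implyP=> w Ww; rewrite !ffunE conjgKV abg.
Qed.

Definition Gorbit (t : Gamma) : {set Gamma} :=
  [set s : Gamma | [exists h in H, val s == Gact h (val t)]].

Definition Gorbit_reps (X : {set Gamma}) : bool :=
  is_transversal X [set Gorbit t | t : Gamma] [set: Gamma].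

End Gamma.

Section DirectSumSpace.
Variables (F : fieldType) (I : finType) (V : I -> vectType F).

Definition dsum := {dffun forall i : I, V i}.
HB.instance Definition _ := Choice.on dsum.
Implicit Types x y z : dsum.

Definition dsum_zero : dsum := [ffun i => 0 : V i].
Definition dsum_opp x : dsum := [ffun i => - x i].
Definition dsum_add x y : dsum := [ffun i => x i + y i].
Definition dsum_scale (c : F) x : dsum := [ffun i => c *: x i].

Fact dsum_addA : associative dsum_add.
Proof. by move=> x y z; apply/ffunP=> i; rewrite !ffunE addrA. Qed.
Fact dsum_addC : commutative dsum_add.
Proof. by move=> x y; apply/ffunP=> i; rewrite !ffunE addrC. Qed.
Fact dsum_add0 : left_id dsum_zero dsum_add.
Proof. by move=> x; apply/ffunP=> i; rewrite !ffunE add0r. Qed.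
Fact dsum_addN : left_inverse dsum_zero dsum_opp dsum_add.
Proof. by move=> x; apply/ffunP=> i; rewrite !ffunE addNr. Qed.
HB.instance Definition _ :=
  GRing.isZmodule.Build dsum dsum_addA dsum_addC dsum_add0 dsum_addN.

Fact dsum_scaleA c d x : dsum_scale c (dsum_scale d x) = dsum_scale (c * d) x.
Proof. by apply/ffunP=> i; rewrite !ffunE scalerA. Qed.
Fact dsum_scale1 : left_id 1 dsum_scale.
Proof. by move=> x; apply/ffunP=> i; rewrite ffunE scale1r. Qed.
Fact dsum_scaleDr : right_distributive dsum_scale +%R.
Proof. by move=> c x y; apply/ffunP=> i; rewrite !ffunE scalerDr. Qed.
Fact dsum_scaleDl x : {morph dsum_scale^~ x : c d / c + d}.
Proof. by move=> c d; apply/ffunP=> i; rewrite !ffunE scalerDl. Qed.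
HB.instance Definition _ := GRing.Zmodule_isLmodule.Build F dsum
  dsum_scaleA dsum_scale1 dsum_scaleDr dsum_scaleDl.

Let p_ (k : 'I_#|I|) := dim (V (enum_val k)).

Fact dsum_vect : Vector.axiom (\sum_k p_ k)%N dsum.
Proof.
exists (fun x => \mxrow_k (v2r (x (enum_val k)) : 'rV_(p_ k))).
  have submxrowL c (A B : 'rV[F]_(\sum_k p_ k)) k :
      submxrow (c *: A + B) k = c *: submxrow A k + submxrow B k.
    by apply/rowP=> j; rewrite !mxE.
  by move=> c x y; apply/mxrowP=> k; rewrite submxrowL !mxrowK !ffunE linearP.
pose inv (u : 'rV[F]_(\sum_k p_ k)) : dsum :=
  [ffun i => ecast i (V i) (enum_rankK i) 
     (@r2v _ (V (enum_val (enum_rank i))) (submxrow u (enum_rank i)))].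
have invE u k : inv u (enum_val k) = @r2v _ (V (enum_val k)) (submxrow u k).
  rewrite ffunE; move: (enum_rankK _); rewrite enum_valK => e.
  by rewrite (eq_axiomK e).
exists inv => [x | u].
  by apply/ffunP=> i; rewrite -(enum_rankK i) invE mxrowK v2rK.
by apply/mxrowP=> k; rewrite mxrowK invE r2vK.
Qed.
HB.instance Definition _ := Lmodule_hasFinDim.Build F dsum dsum_vect.

Definition dsum_inj (i : I) (v : V i) : dsum :=
  [ffun j => dfwith (fun k => 0 : V k) v j].

End DirectSumSpace.

Section DirectSum.
Variables (F : fieldType) (gT : finGroupType) (G : {group gT}) (I : finType).
Variable M : I -> gmodule F G.

Definition dsum_fun (g : gT) (x : dsum M) : dsum M :=
  [ffun i => mact (M i) g (x i)].

Fact dsum_fun_linear g : linear (dsum_fun g).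
Proof. by move=> c x y; apply/ffunP=> i; rewrite !ffunE linearP. Qed.
HB.instance Definition _ g :=
  GRing.isLinear.Build F (dsum M) (dsum M) _ (dsum_fun g) (dsum_fun_linear g).

Fact dsum_mact1 : linfun (dsum_fun 1%g) = \1%VF.
Proof.
by apply/lfunP=> x; rewrite !lfunE; apply/ffunP=> i; rewrite ffunE mact1 id_lfunE.
Qed.

Fact dsum_mactM : {in G &, forall g h,
  linfun (dsum_fun (g * h)%g) = (linfun (dsum_fun g) \o linfun (dsum_fun h))%VF}.
Proof.
move=> g h Gg Gh; apply/lfunP=> x; rewrite comp_lfunE !lfunE /=.
by apply/ffunP=> i; rewrite !ffunE mactM // comp_lfunE.
Qed.

Definition gdsum : gmodule F G := GModule dsum_mact1 dsum_mactM.

Definition gdsum_inj (i : I) (v : M i) : gdsum :=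
  dsum_inj (V := fun i => M i) v.

End DirectSum.
Arguments gdsum_inj {F gT G I} M i v.

Definition Gamma_tensor (F : fieldType) (gT hT kT : finGroupType)
    (G : {group gT}) (H : {group hT}) (K : {group kT})
    (M : bimodule F G H) (N : bimodule F H K)
    (U : {group gT}) (W : {group kT}) (sUG : U \subset G) (sWK : W \subset K)
    (gamma : epi U W) (t : Gamma H gamma) : bimodule F 'C_G(U)%G 'C_K(W)%G :=
  btens (brauer_lhd M (Galpha t) sUG (GV_sub t))
        (brauer_lhd N (Gbeta t) (GV_sub t) sWK).

(* Main.v *)
(* Idea.  A retract of F[Z] is handled through the coordinates and the vectors
   indexed by Z.  If L is a retract of F[X] that is projective relative to P,
   then L is a retract of F[(G x H)/P * X], on which G x 1 acts freely as soon
   as P belongs to lhd_{G,H}; hence M and N are retracts of F[X] and F[Y] with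
   G x 1 free on X and H x 1 free on Y, and M (x)_{FH} N is a retract of
   F[X x_H Y].  In characteristic p, the Brauer construction at a p-group P only
   sees the coordinates at the P-fixed points.

   If lhd(U,gamma,W) fixes the H-orbit of (x,y), freeness yields a unique triple
   (a',V',b') such that lhd(U,a',V') fixes x and lhd(V',b',W) fixes y.  The
   coordinate of m (x) n at this orbit is a sum over H of products of
   coordinates of m and n.  For m and n fixed by the groups of a triple
   (a,V,b), its terms are constant on the orbits of the p-group W acting on H by
   h |-> b'(w)^-1 h b(w), so only the h with h b = b' h survive: there is none
   if the two triples are not H-conjugate, and they form C_H(V) if the triples
   are equal, in which case the sum is the coordinate of the tensor product of
   the classes of m and n over FC_H(V). *)
From HB Require Import structures.
From Stdlib Require Import Classical.
From mathcomp Require Import all_boot all_order all_algebra all_fingroup pgroup.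
Require Import Defs.

Set Implicit Arguments.
Unset Strict Implicit.
Unset Printing Implicit Defensive.

Import GroupScope GRing.Theory.
Import VectorInternalTheory.
Local Open Scope ring_scope.

(** * Linear maps from linear and bilinear functions *)

Section LinearFunctions.
Variables (F : fieldType) (U V : vectType F).

(** A linear structure is packed from the proof of linearity, so that [linfun] can be used on
    functions for which none is declared. *)
Lemma linfunK (f : U -> V) : linear f -> linfun f =1 f.
Proof.
move=> lf u.
pose g : {linear U -> V} := HB.pack f (GRing.isLinear.Build _ _ _ _ f lf).
by rewrite -[f]/(g : U -> V) lfunE.
Qed.

Lemma lin_sum (f : U -> V) (I : Type) (s : seq I) P (E : I -> U) :
  linear f -> f (\sum_(i <- s | P i) E i) = \sum_(i <- s | P i) f (E i).
Proof.
move=> lf; rewrite -(linfunK lf) linear_sum.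
by apply: eq_bigr => i _; apply: linfunK.
Qed.

Lemma lin_scale (f : U -> V) c u : linear f -> f (c *: u) = c *: f u.
Proof. by move=> lf; rewrite -!(linfunK lf) linearZ. Qed.

Lemma lin_sub (f : U -> V) x y : linear f -> f (x - y) = f x - f y.
Proof. by move=> lf; rewrite -!(linfunK lf) linearB. Qed.

Lemma v2r_expand (u : U) : u = \sum_i (v2r u) 0 i *: r2v (delta_mx 0 i).
Proof.
rewrite -[LHS]v2rK {1}[v2r u]row_sum_delta linear_sum.
by apply: eq_bigr => i _; rewrite linearZ.
Qed.

End LinearFunctions.

Section TensorLift.
Variables (F : fieldType) (hT : finGroupType) (M N V : vectType F).
Variables (H : {group hT}) (r : hT -> 'End(M)) (l : hT -> 'End(N)).

Lemma tpure_linearl n : linear (fun m => tpure H r l m n).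
Proof. by move=> c m m'; rewrite /tpure pureF_linearl linearP. Qed.

Lemma tpure_linearr m : linear (tpure H r l m).
Proof. by move=> c n n'; rewrite /tpure pureF_linearr linearP. Qed.

Lemma tens_eq (f g : 'Hom(tensor H r l, V)) :
  (forall m n, f (tpure H r l m n) = g (tpure H r l m n)) -> f =1 g.
Proof.
move=> fg x; rewrite -[x]sqpi_repr; set y := sqrepr _ _ x.
have [c ->] := tensF_span y.
rewrite !linear_sum; apply: eq_bigr => i _; rewrite !linear_sum.
apply: eq_bigr => j _; rewrite !linearZ /=; congr (_ *: _); exact: fg.
Qed.

Definition bilinear_fun (b : M -> N -> V) : Prop :=
  (forall n, linear (b^~ n)) /\ (forall m, linear (b m)).

Definition pre_lift (b : M -> N -> V) (x : tensF M N) : V :=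
  \sum_i \sum_j (x : 'M_(_, _)) i j *:
     b (r2v (delta_mx 0 i)) (r2v (delta_mx 0 j)).

Lemma pre_lift_linear b : linear (pre_lift b).
Proof.
move=> c x y; rewrite /pre_lift scaler_sumr -big_split; apply: eq_bigr => i _.
rewrite scaler_sumr -big_split; apply: eq_bigr => j _ /=.
by rewrite !mxE scalerDl scalerA.
Qed.

Lemma pre_lift_pure b m n : bilinear_fun b -> pre_lift b (pureF m n) = b m n.
Proof.
move=> [bl br]; rewrite {2}[m]v2r_expand (lin_sum _ _ _ (bl n)).
apply: eq_bigr => i _; rewrite (lin_scale _ _ (bl n)).
rewrite {2}[n]v2r_expand (lin_sum _ _ _ (br _)) scaler_sumr.
apply: eq_bigr => j _; rewrite (lin_scale _ _ (br _)) scalerA; congr (_ *: _).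
by rewrite /pureF mxE big_ord1 !mxE.
Qed.

(** The composite with the section [sqrepr] is linear for every [b]; its values on pure tensors are
    those of [b] once [b] is bilinear and balanced, by [tens_liftE]. *)
Definition tens_lift (b : M -> N -> V) : 'Hom(tensor H r l, V) :=
  (linfun (pre_lift b) \o sqrepr fullv (tensor_rel H r l))%VF.

Lemma tens_liftE b m n : bilinear_fun b ->
  {in H, forall h m n, b (r h m) n = b m (l h n)} ->
  tens_lift b (tpure H r l m n) = b m n.
Proof.
move=> bb bH; have bl := @pre_lift_linear b.
rewrite comp_lfunE -(pre_lift_pure m n bb) -(linfunK bl).
(* The chosen representative of the class of [pureF m n] differs from it by a relation, so it
   suffices that the generators of [tensor_rel] lie in the kernel of the lift. *)
have := sqpi_reprB (tensor_rel H r l) (memvf (pureF m n)).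
rewrite -/(tpure H r l m n); set x := sqrepr _ _ _ => relx.
apply/eqP; rewrite -subr_eq0 -linearB /=; move: relx; move: (x - _) => {}x.
rewrite -memv_ker; apply: subvP; apply/subv_sumP => h Hh.
apply/subvP=> _ /memv_imgP[y _ ->]; rewrite memv_ker; have [c ->] := tensF_span y.
rewrite !linear_sum big1 // => i _; rewrite !linear_sum big1 // => j _.
rewrite !linearZ /= add_lfunE opp_lfunE !tmapF_pure !id_lfunE linearB /=.
by rewrite !linfunK // !pre_lift_pure // bH // subrr scaler0.
Qed.

End TensorLift.

Lemma daddv_piD (F : fieldType) (V : vectType F) (A B : {vspace V}) u v :
  (A :&: B = 0)%VS -> u \in A -> v \in B -> daddv_pi A B (u + v) = u.
Proof.
move=> dAB Au Bv; rewrite linearD /= daddv_pi_id // -[RHS]addr0; congr (_ + _).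
have vAB : v \in (A + B)%VS by apply: subvP (addvSr A B) _ Bv.
have := daddv_pi_add dAB vAB; rewrite (@daddv_pi_id _ _ B) 1?capvC //.
by rewrite -[RHS](add0r v) => /addIr.
Qed.

(** * Direct summands as split monomorphisms *)

Section Retracts.
Variables (F : fieldType) (gT : finGroupType) (G : {group gT}).
Implicit Types L M N : gmodule F G.

(** Equivalent to [isom_to_summand], but the two maps compose easily and carry coordinates and
    vectors from [M] to [L]. *)
Definition retract L M : Prop :=
  exists (f : 'Hom(L, M)) (s : 'Hom(M, L)),
    [/\ gmod_hom f, gmod_hom s & cancel f s].

Lemma retract_trans L M N : retract L M -> retract M N -> retract L N.
Proof.
case=> f [s [hf hs sK]] [f' [s' [hf' hs' sK']]].
exists (f' \o f)%VF, (s \o s')%VF; split=> [g Gg m | g Gg m | m].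
- by rewrite !comp_lfunE hf ?hf'.
- by rewrite !comp_lfunE hs' ?hs.
- by rewrite !comp_lfunE sK' sK.
Qed.

Lemma retract_isom_to_summand L M : retract L M -> isom_to_summand L M.
Proof.
case=> f [s [hf hs sK]]; exists f; split=> //.
  by apply/eqP/lker0P; apply: can_inj sK.
split=> [g Gg|].
  apply/subvP=> _ /memv_imgP[_ /memv_imgP[m _ ->] ->].
  by rewrite -hf // memv_img ?memvf.
exists (lker s); split=> [g Gg | |].
- apply/subvP=> _ /memv_imgP[m sm ->]; move: sm; rewrite !memv_ker hs //.
  by move/eqP->; rewrite linear0.
- apply/eqP; rewrite eqEsubv subvf; apply/subvP=> m _.
  rewrite -[m](subrK (f (s m))) addrC memv_add ?memv_img ?memvf //.
  by rewrite memv_ker linearB /= sK subrr.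
- apply/eqP; rewrite -subv0; apply/subvP=> _ /memv_capP[/memv_imgP[m _ ->]].
  by rewrite memv_ker sK => /eqP->; rewrite linear0 memv0.
Qed.

Lemma isom_to_summand_retract L M : isom_to_summand L M -> retract L M.
Proof.
case=> f [hf kf [stI [B [stB fB dIB]]]].
have injf : injective f by apply/lker0P; rewrite kf.
pose pr := daddv_pi (limg f) B.
have prE m : m = pr m + (m - pr m) by rewrite addrC subrK.
have prB m : m - pr m \in B.
  have mfB : m \in (limg f + B)%VS by rewrite fB memvf.
  by rewrite -{1}(daddv_pi_add dIB mfB) [X in X - _]addrC addrK memv_pi.
have prU x y : x \in limg f -> y \in B -> pr (x + y) = x by apply: daddv_piD.
exists f, (f^-1 \o pr)%VF; split=> // [g Gg m | m]; last first.
  rewrite comp_lfunE -[f m]addr0 prU ?memv_img ?memvf ?mem0v //.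
  by rewrite lker0_lfunK // kf.
(* Equivariance of the retraction is tested after the injection [f]: [g] keeps the two parts of [m]
   inside [limg f] and [B], so it commutes with the projection along [B]. *)
apply: injf; rewrite hf // !comp_lfunE !limg_lfunVK ?memv_pi //.
rewrite {1}[m]prE linearD /= prU //.
  by apply: subvP (stI g Gg) _ (memv_img _ (memv_pi _ _ _)).
by apply: subvP (stB g Gg) _ (memv_img _ (prB m)).
Qed.

End Retracts.

(** * Coordinates indexed by a G-set *)

Section OrbitSums.
Variables (gT : finGroupType) (A P : {group gT}) (Z : finType) (to : action A Z).
Variables (V : nmodType) (S : {set Z}).
Hypothesis actP : [acts P, on S | to].

Lemma sum_orbits (f : Z -> V) :
  \sum_(z in S) f z = \sum_(O in orbit to P @: S) \sum_(z in O) f z.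
Proof.
have /and3P[/eqP cS tI _] := orbit_partition actP.
by rewrite -{1}cS big_trivIset.
Qed.

(** The one-point orbits are those of the fixed points, so the set difference leaves the orbits with
    at least two points. *)
Lemma sum_fixed_orbits (f : Z -> V) :
  \sum_(z in S) f z = \sum_(z in S | z \in 'Fix_to(P)) f z
    + \sum_(O in orbit to P @: S :\: orbit to P @: 'Fix_(S | to)(P))
        \sum_(z in O) f z.
Proof.
rewrite sum_orbits (big_setID (orbit to P @: 'Fix_(S | to)(P))) /=; congr (_ + _).
have sFS : orbit to P @: 'Fix_(S | to)(P) \subset orbit to P @: S.
  by apply: imsetS; apply: subsetIl.
rewrite (setIidPr sFS).
have orb1 z : z \in 'Fix_(S | to)(P) -> orbit to P z = [set z].
  by case/setIP=> _ /afixP fz; apply/orbit1P/afixP.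
rewrite big_imset /=; last first.
  by move=> y z Fy Fz; rewrite !orb1 // => /set1_inj.
apply: eq_big => [z | z Fz]; first by rewrite inE.
by rewrite orb1 // big_set1.
Qed.

End OrbitSums.

(** The index is a power of [p] other than 1. *)
Lemma pgroup_index0 (F : fieldType) (p : nat) (charF : p \in [pchar F])
    (gT : finGroupType) (P Q : {group gT}) :
  (p.-group P)%g -> Q \proper P -> (#|P : Q|%g)%:R = 0 :> F.
Proof.
move=> pP prQP; have sQP := proper_sub prQP.
apply/eqP; rewrite -(dvdn_pcharf charF).
have pr_p := pcharf_prime charF.
have := pnat_dvd (dvdn_indexg P Q) pP.
case/p_natP => k e; rewrite e; case: k e => [|k _]; last by rewrite expnS dvdn_mulr.
by move/eqP; rewrite expn0 indexg_eq1 => sPQ; case/properP: prQP => _ [x /(subsetP sPQ) ->].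
Qed.

(** The orbit of a point that is not fixed contributes its length times a constant, and its length
    is the index of a proper subgroup of the [p]-group [P]. *)
Lemma sum_pgroup_fixed (F : fieldType) (p : nat) (charF : p \in [pchar F])
    (gT : finGroupType) (A P : {group gT}) (Z : finType) (to : action A Z)
    (S : {set Z}) (f : Z -> F) :
  (p.-group P)%g -> [acts P, on S | to] ->
  {in S, forall z, {in P, forall g, f (to z g) = f z}} ->
  \sum_(z in S) f z = \sum_(z in S | z \in 'Fix_to(P)) f z.
Proof.
move=> pP actP fP; rewrite (sum_fixed_orbits actP) [X in _ + X]big1 ?addr0 // => O.
case/setDP=> /imsetP[z Sz ->] nF.
rewrite (eq_bigr (fun=> f z)) => [|_ /orbitP[g Pg <-]]; last exact: fP.
have sPA : P \subset A by apply: subset_trans (acts_dom actP) _.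
rewrite sumr_const card_orbit_in // -mulr_natr (pgroup_index0 charF) ?mulr0 //.
rewrite properEneq subsetIl andbT; apply: contraNneq nF => eqP.
apply: imset_f; rewrite inE Sz; apply/afixP=> g Pg.
by move: Pg; rewrite -{1}eqP => /setIP[_ /astab_act->] //; apply: set11.
Qed.

Lemma mem_astab1 (gT : finGroupType) (A : {group gT}) (Z : finType)
    (to : action A Z) g z : g \in A -> (g \in 'C[z | to]%g) = (to z g == z).
Proof. by move=> Ag; rewrite !inE Ag sub1set inE. Qed.

(* A frame realizes L as a retract of the permutation module on fdom: fco z is
   the coordinate at z of the embedding and fvec z the image of the point mass
   at z under the retraction.  As in perm_gmod, fto is a right action, so that
   the left action of g on points is fto z g^-1. *)
Record frame (F : fieldType) (gT : finGroupType) (G : {group gT})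
    (L : gmodule F G) := Frame {
  fpt : finType;
  fto : fpt -> gT -> fpt;
  fdom : {set fpt};
  fco : fpt -> 'Hom(L, F^o);
  fvec : fpt -> L;
  fto_action : is_action G fto;
  fdom_to : {in G, forall g z, (fto z g \in fdom) = (z \in fdom)};
  fco_act : {in G & fdom, forall g z u, fco z (mact L g u) = fco (fto z g) u};
  fvec_act : {in G & fdom, forall g z, mact L g (fvec (fto z g)) = fvec z};
  frame_sum : forall u, u = \sum_(z in fdom) fco z u *: fvec z
}.

Section FrameTheory.
Variables (F : fieldType) (gT : finGroupType) (G : {group gT}).
Variables (L : gmodule F G) (fr : frame L).

Definition faction := Action (fto_action fr).

Lemma fto1 z : fto (f := fr) z 1%g = z.
Proof. exact: (act1 faction). Qed.

Lemma ftoM z : {in G &, forall g h, fto (f := fr) z (g * h)%g = fto (fto z g) h}.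
Proof. by move=> g h Gg Gh; apply: (actMin faction). Qed.

Lemma ftoK z g : g \in G -> fto (fto (f := fr) z g) g^-1%g = z.
Proof. by move=> Gg; apply: (actKin faction). Qed.

Lemma ftoKV z g : g \in G -> fto (fto (f := fr) z g^-1%g) g = z.
Proof. by move=> Gg; apply: (actKVin faction). Qed.

Lemma fvec_actV g z : g \in G -> z \in fdom fr ->
  mact L g (fvec z) = fvec (fto z g^-1%g).
Proof.
move=> Gg Dz; rewrite -{1}(ftoKV z Gg).
by rewrite fvec_act // fdom_to ?groupV.
Qed.

Variables (P : {group gT}) (sPG : P \subset G).

Definition ffix : {set fpt fr} := [set z in fdom fr | [forall g in P, fto z g == z]].

Lemma ffixP z :
  reflect (z \in fdom fr /\ {in P, forall g, fto z g = z}) (z \in ffix).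
Proof.
rewrite inE; apply: (iffP andP) => -[Dz fz]; split=> //.
  by move=> g Pg; apply/eqP; apply: (forall_inP fz).
by apply/forall_inP=> g Pg; rewrite fz.
Qed.

Lemma ffixE : ffix = 'Fix_(fdom fr | faction)(P).
Proof.
apply/setP=> z; apply/ffixP/setIP => -[Dz fz]; split=> //; first exact/afixP.
by move/afixP: fz.
Qed.

Lemma acts_fdom : [acts P, on fdom fr | faction].
Proof.
apply/subsetP=> g Pg; rewrite !inE (subsetP sPG) //=.
by apply/subsetP=> z; rewrite inE /= fdom_to // (subsetP sPG).
Qed.

Lemma fixv_fvec z : z \in ffix -> fvec z \in fixv L P.
Proof.
case/ffixP=> Dz fz; apply/fixvP=> g Pg.
by rewrite -{1}(fz g Pg) fvec_act // (subsetP sPG).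
Qed.

Lemma fco_fix u z g : u \in fixv L P -> g \in P -> z \in fdom fr ->
  fco (fto z g) u = fco z u.
Proof.
move=> /fixvP fu Pg Dz; rewrite -fco_act ?(subsetP sPG) //.
by rewrite fu.
Qed.

(** [Q] is the stabilizer of [z] in [P], so the cosets xQ correspond bijectively to the points
    [fto z x^-1] of the orbit, and x maps [fvec z] to the vector at that point. *)
Lemma trace_fvec z (Q := 'C_P[z | faction]%G) : z \in fdom fr ->
  trace L Q P (fvec z) = \sum_(y in orbit faction P z) fvec y.
Proof.
move=> Dz; have sQP : Q \subset P by apply: subsetIl.
have Grep C : C \in lcosets Q P -> repr C \in P.
  case/lcosetsP=> x Px ->; have: (repr (x *: Q) \in x *: Q)%g.
    by apply: mem_repr (lcoset_refl Q x).
  by case/lcosetP=> y Qy ->; rewrite groupM // (subsetP sQP).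
have PG := subsetP sPG.
pose f C := fto (f := fr) z (repr C)^-1%g.
transitivity (\sum_(C in lcosets Q P) fvec (f C)).
  rewrite sum_lfunE; apply: eq_bigr => C QPC.
  by rewrite fvec_actV // PG ?Grep.
have -> : orbit faction P z = f @: lcosets Q P.
  apply/setP=> y; apply/orbitP/imsetP => [[g Pg <-] | [C QPC ->]]; last first.
    by exists (repr C)^-1%g; rewrite ?groupV ?Grep.
  have QPC : (g^-1 *: Q)%g \in lcosets Q P.
    by apply/lcosetsP; exists g^-1%g; rewrite ?groupV.
  exists (g^-1 *: Q)%g => //; rewrite /f.
  have: (repr (g^-1 *: Q) \in g^-1 *: Q)%g by apply: mem_repr (lcoset_refl Q _).
  case/lcosetP=> q Qq ->; rewrite invMg invgK.
  have Pq := subsetP sQP q Qq; rewrite ftoM ?groupV ?PG //; congr fto.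
  by move: Qq; rewrite -groupV => /setIP[_ /astab_act/(_ (set11 z))].
rewrite [RHS]big_imset // => C D QPC QPD fCD.
have [PC PD] := (Grep _ QPC, Grep _ QPD).
have: ((repr C)^-1 * repr D)%g \in Q.
  rewrite inE mem_astab1 ?groupM ?groupV ?PG //=; apply/eqP.
  by rewrite ftoM ?groupV ?PG // -/(f C) fCD /f ftoKV ?PG.
case/lcosetsP: QPC fCD PC => x Px eC _ PC QCD.
have memr E : E \in lcosets Q P -> E = (repr E *: Q)%g.
  case/lcosetsP=> y Py ->; apply/lcoset_eqP.
  by rewrite lcoset_sym; apply: mem_repr (lcoset_refl Q y).
rewrite (memr D) // (memr C); last by rewrite eC; apply/lcosetsP; exists x.
by apply/lcoset_eqP; rewrite lcoset_sym mem_lcoset.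
Qed.

(* A non-trivial P-orbit contributes the trace of a vector fixed by a proper
   subgroup of P, namely a stabilizer. *)
Lemma fixv_frame u : u \in fixv L P ->
  u - \sum_(z in ffix) fco z u *: fvec z \in traces L P.
Proof.
move=> fu; rewrite {1}[u](frame_sum fr) (sum_fixed_orbits acts_fdom).
rewrite ffixE; set S1 := \sum_(z in _ | _) _; set S2 := \sum_(z in _ :&: _) _.
have -> : S1 = S2 by apply: eq_bigl => z; rewrite in_setI.
rewrite addrC addKr; apply: rpred_sum => O /setDP[/imsetP[z Dz ->] nF].
rewrite (eq_bigr (fun y : fpt fr => fco z u *: fvec y)) => [|_ /orbitP[g Pg <-]]; last first.
  by rewrite /= fco_fix.
rewrite -scaler_sumr -trace_fvec //; apply: memvZ.
have prQ : 'C_P[z | faction]%G \proper P.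
  rewrite properEneq subsetIl andbT; apply: contraNneq nF => /= eqP.
  apply: imset_f; rewrite inE Dz; apply/afixP=> g Pg.
  by move: Pg; rewrite -{1}eqP => /setIP[_ /astab_act->] //; apply: set11.
have sT : (trace L 'C_P[z | faction]%G P @: fixv L 'C_P[z | faction]%G
    <= traces L P)%VS by apply: sumv_sup (subvv _).
apply: subvP sT _ (memv_img _ _).
apply/fixvP=> g /setIP[Pg /astab_act/(_ (set11 z))/= zg].
by rewrite -{1}zg fvec_act // (subsetP sPG).
Qed.

(** As [P] fixes [z], all terms of a trace from a proper subgroup [Q] have the same coordinate at
    [z], and their number |P : Q| is 0 in [F]. *)
Lemma fco_traces (p : nat) u z : p \in [pchar F] -> (p.-group P)%g ->
  u \in traces L P -> z \in ffix -> fco z u = 0.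
Proof.
move=> charF pP tu /ffixP[Dz fz].
apply/eqP; rewrite -memv_ker; move: tu; apply: subvP; apply/subv_sumP=> Q prQP.
apply/subvP=> _ /memv_imgP[m fm ->]; have sQP := proper_sub prQP.
rewrite memv_ker sum_lfunE linear_sum /=.
rewrite (eq_bigr (fun=> fco z m)) => [|C].
  rewrite sumr_const card_lcosets -mulr_natr.
  by rewrite (pgroup_index0 charF pP prQP) mulr0.
case/lcosetsP=> x Px ->; have: (repr (x *: Q) \in x *: Q)%g.
  by apply: mem_repr (lcoset_refl Q x).
case/lcosetP=> y Qy ->; have Pxy : (x * y)%g \in P by rewrite groupM // (subsetP sQP).
by rewrite fco_act ?fz // (subsetP sPG).
Qed.

End FrameTheory.

(** * Frames of permutation modules, retracts, sums and restrictions *)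

Section PermutationFrame.
Variables (F : fieldType) (gT : finGroupType) (G : {group gT}).
Variables (X : finType) (to : action G X).

Definition ffun_coord (x : X) : 'Hom({ffun X -> F^o}, F^o) := linfun (fun f : {ffun X -> F^o} => f x).

Lemma ffun_coordE x (f : {ffun X -> F^o}) : ffun_coord x f = f x.
Proof. by apply: linfunK => c f1 f2; rewrite !ffunE. Qed.

Definition point_mass (x : X) : {ffun X -> F^o} := [ffun y => (y == x)%:R : F].

Lemma ffun_point_mass (f : {ffun X -> F^o}) : f = \sum_x f x *: point_mass x.
Proof.
apply/ffunP=> y; rewrite sum_ffunE (bigD1 y) //= !ffunE eqxx big1 ?addr0.
  by rewrite [_ *: _]mulr1.
by move=> x; rewrite !ffunE eq_sym => /negPf->; rewrite scaler0.
Qed.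

Fact perm_frame_action : is_action G to.
Proof. by case: to. Qed.

Fact perm_frame_dom : {in G, forall g z, (to z g \in [set: X]) = (z \in [set: X])}.
Proof. by move=> g Gg z; rewrite !inE. Qed.

Fact perm_frame_co : {in G & [set: X], forall g z (u : perm_gmod F to),
  ffun_coord z (mact (perm_gmod F to) g u) = ffun_coord (to z g) u}.
Proof. by move=> g z Gg _ u; rewrite !ffun_coordE lfunE ffunE. Qed.

Fact perm_frame_vec : {in G & [set: X], forall g z,
  mact (perm_gmod F to) g (point_mass (to z g)) = point_mass z}.
Proof.
move=> g z Gg _; rewrite lfunE; apply/ffunP=> x; rewrite !ffunE.
by rewrite (inj_eq (act_inj to g)).
Qed.

Fact perm_frame_sum (u : perm_gmod F to) :
  u = \sum_(z in [set: X]) ffun_coord z u *: (point_mass z : perm_gmod F to).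
Proof.
rewrite {1}[u]ffun_point_mass; apply: eq_big => [z | z _]; first by rewrite inE.
by rewrite ffun_coordE.
Qed.

Definition perm_frame : frame (perm_gmod F to) :=
  Frame perm_frame_action perm_frame_dom perm_frame_co perm_frame_vec
    perm_frame_sum.

End PermutationFrame.

Section FrameRetract.
Variables (F : fieldType) (gT : finGroupType) (G : {group gT}).
Variables (L M : gmodule F G) (f : 'Hom(L, M)) (s : 'Hom(M, L)).
Hypotheses (hf : gmod_hom f) (hs : gmod_hom s) (sK : cancel f s).
Variable fr : frame M.

Fact retract_frame_co : {in G & fdom fr, forall g z u,
  (fco z \o f)%VF (mact L g u) = (fco (fto (f := fr) z g) \o f)%VF u}.
Proof. by move=> g z Gg Dz u; rewrite !comp_lfunE hf // fco_act. Qed.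

Fact retract_frame_vec : {in G & fdom fr, forall g z,
  mact L g (s (fvec (fto (f := fr) z g))) = s (fvec z)}.
Proof. by move=> g z Gg Dz; rewrite -hs // fvec_act. Qed.

Fact retract_frame_sum u :
  u = \sum_(z in fdom fr) (fco z \o f)%VF u *: s (fvec z).
Proof.
rewrite -{1}[u]sK {1}[f u](frame_sum fr) linear_sum; apply: eq_bigr => z _.
by rewrite linearZ comp_lfunE.
Qed.

Definition retract_frame : frame L :=
  Frame (fto_action fr) (@fdom_to _ _ _ _ fr) retract_frame_co retract_frame_vec
    retract_frame_sum.

End FrameRetract.

Section FrameSum.
Variables (F : fieldType) (gT : finGroupType) (G : {group gT}).
Variables (L L1 L2 : gmodule F G).
Variables (i1 : 'Hom(L1, L)) (p1 : 'Hom(L, L1)) (i2 : 'Hom(L2, L)) (p2 : 'Hom(L, L2)).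
Hypotheses (hi1 : gmod_hom i1) (hp1 : gmod_hom p1).
Hypotheses (hi2 : gmod_hom i2) (hp2 : gmod_hom p2).
Hypothesis decL : forall u, u = i1 (p1 u) + i2 (p2 u).
Variables (fr1 : frame L1) (fr2 : frame L2).

Notation Z := (fpt fr1 + fpt fr2)%type.

Definition sum_to (z : Z) g : Z :=
  match z with inl x => inl (fto x g) | inr y => inr (fto y g) end.

Definition sum_dom : {set Z} :=
  [set z : Z | match z with inl x => x \in fdom fr1 | inr y => y \in fdom fr2 end].

Definition sum_co (z : Z) : 'Hom(L, F^o) :=
  match z with inl x => (fco x \o p1)%VF | inr y => (fco y \o p2)%VF end.

Definition sum_vec (z : Z) : L :=
  match z with inl x => i1 (fvec x) | inr y => i2 (fvec y) end.

Fact sum_frame_action : is_action G sum_to.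
Proof.
split=> [g [x|y] [x'|y'] //= [] e | [x|y] g h Gg Gh /=].
- by congr inl; apply: (act_inj (faction fr1) g).
- by congr inr; apply: (act_inj (faction fr2) g).
- by rewrite ftoM.
- by rewrite ftoM.
Qed.

Fact sum_frame_dom : {in G, forall g z, (sum_to z g \in sum_dom) = (z \in sum_dom)}.
Proof. by move=> g Gg [x|y]; rewrite !inE /= fdom_to. Qed.

Fact sum_frame_co : {in G & sum_dom, forall g z u,
  sum_co z (mact L g u) = sum_co (sum_to z g) u}.
Proof.
by move=> g [x|y] Gg; rewrite inE /= => Dz u; rewrite !comp_lfunE ?hp1 ?hp2 // fco_act.
Qed.

Fact sum_frame_vec : {in G & sum_dom, forall g z,
  mact L g (sum_vec (sum_to z g)) = sum_vec z}.
Proof.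
by move=> g [x|y] Gg; rewrite inE /= => Dz; rewrite -?hi1 -?hi2 // fvec_act.
Qed.

Fact sum_frame_sum u : u = \sum_(z in sum_dom) sum_co z u *: sum_vec z.
Proof.
rewrite {1}[u]decL {1}[p1 u](frame_sum fr1) {1}[p2 u](frame_sum fr2) !linear_sum.
rewrite big_sumType /=; congr (_ + _).
  apply: eq_big => [x | x _]; first by rewrite inE.
  by rewrite linearZ comp_lfunE.
apply: eq_big => [x | x _]; first by rewrite inE.
by rewrite linearZ comp_lfunE.
Qed.

Definition sum_frame : frame L :=
  Frame sum_frame_action sum_frame_dom sum_frame_co sum_frame_vec sum_frame_sum.

End FrameSum.

Section FrameRestriction.
Variables (F : fieldType) (gT : finGroupType) (G P : {group gT}).
Variables (sPG : P \subset G) (L : gmodule F G) (fr : frame L).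

Fact res_frame_action : is_action P (fto (f := fr)).
Proof.
split=> [g | z g h Pg Ph]; first exact: (act_inj (faction fr)).
by rewrite ftoM // (subsetP sPG).
Qed.

Fact res_frame_dom :
  {in P, forall g (z : fpt fr), (fto z g \in fdom fr) = (z \in fdom fr)}.
Proof. by move=> g Pg z; rewrite fdom_to // (subsetP sPG). Qed.

Fact res_frame_co : {in P & fdom fr, forall g z u,
  fco (f := fr) z (mact (gres sPG L) g u) = fco (f := fr) (fto (f := fr) z g) u}.
Proof. by move=> g z Pg Dz u; rewrite fco_act // (subsetP sPG). Qed.

Fact res_frame_vec : {in P & fdom fr, forall g z,
  mact (gres sPG L) g (fvec (f := fr) (fto (f := fr) z g)) = fvec (f := fr) z}.
Proof. by move=> g z Pg Dz; apply: fvec_act Dz; apply: (subsetP sPG). Qed.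

Definition res_frame : frame (gres sPG L) :=
  @Frame _ _ _ (gres sPG L) _ _ _ _ _ res_frame_action res_frame_dom
    res_frame_co res_frame_vec (frame_sum fr).

End FrameRestriction.

(** * Coordinates on the Brauer construction *)

Section FrameBrauer.
Variables (F : fieldType) (p : nat) (charF : p \in [pchar F]).
Variables (gT : finGroupType) (G P : {group gT}) (sPG : P \subset G).
Variables (pP : (p.-group P)%g) (L : gmodule F G) (fr : frame L).

Lemma brcls_eq0 m : m \in fixv L P -> (brcls P m == 0) = (m \in traces L P).
Proof. exact: sqpi_eq0. Qed.

Notation Fix := (ffix fr P).
Notation B := (brauer L sPG).

(** Evaluated on a chosen representative; at a [P]-fixed point the choice does not matter, as the
    coordinate there vanishes on traces. *)
Definition brauer_co (z : fpt fr) : 'Hom(B, F^o) :=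
  (fco z \o sqrepr (fixv L P) (traces L P))%VF.

Lemma brauer_co_cls z m : z \in Fix -> m \in fixv L P ->
  brauer_co z (brcls P m) = fco z m.
Proof.
move=> Fz fm; rewrite comp_lfunE; apply/eqP; rewrite -subr_eq0 -linearB /=.
by rewrite (fco_traces sPG charF pP _ Fz) // sqpi_reprB.
Qed.

Lemma brcls_repr (x : B) : x = brcls P (sqrepr _ _ x).
Proof. by rewrite [RHS]sqpi_repr. Qed.

Lemma brauer_actE g m : g \in 'N_G(P)%g -> m \in fixv L P ->
  mact B g (brcls P m) = brcls P (mact L g m).
Proof.
by move=> Ng fm; apply: sqmapE => //; rewrite (fixv_norm, traces_norm).
Qed.

Lemma fixv_mact g m : g \in 'N_G(P)%g -> m \in fixv L P -> mact L g m \in fixv L P.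
Proof. by move=> Ng fm; apply: subvP (fixv_norm L sPG Ng) _ (memv_img _ fm). Qed.

Fact brauer_frame_action : is_action 'N_G(P)%G (fto (f := fr)).
Proof. exact: (res_frame_action (subsetIl _ _)). Qed.

Fact brauer_frame_dom :
  {in 'N_G(P)%G, forall g z, (fto z g \in Fix) = (z \in Fix)}.
Proof.
move=> g /setIP[Gg Ng] z; have PG := subsetP sPG.
apply/ffixP/ffixP; rewrite fdom_to // => -[Dz fz]; split=> // x Px.
  have Pxg : (x ^ g)%g \in P by rewrite memJ_norm.
  apply: (act_inj (faction fr) g); rewrite /= -[RHS](fz _ Pxg).
  by rewrite -!ftoM // ?PG // -conjgC.
have PxV : (x ^ g^-1)%g \in P by rewrite memJ_norm ?groupV.
by rewrite -[in RHS](fz _ PxV) -!ftoM ?groupM ?groupV // ?PG //; congr fto; rewrite conjgE invgK !mulgA mulgKV.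
Qed.

Fact brauer_frame_co : {in 'N_G(P)%G & Fix, forall g z u,
  brauer_co z (mact B g u) = brauer_co (fto (f := fr) z g) u}.
Proof.
move=> g z Ng Fz u; rewrite [u]brcls_repr; have fu := sqreprP u.
rewrite brauer_actE // !brauer_co_cls ?brauer_frame_dom ?fixv_mact //.
case/setIP: Ng => Gg _; case/ffixP: Fz => Dz _; exact: fco_act.
Qed.

Fact brauer_frame_vec : {in 'N_G(P)%G & Fix, forall g z,
  mact B g (brcls P (fvec (fto (f := fr) z g))) = brcls P (fvec z)}.
Proof.
move=> g z Ng Fz; rewrite brauer_actE ?(fixv_fvec sPG) ?brauer_frame_dom //.
case/setIP: Ng => Gg _; case/ffixP: Fz => Dz _; by rewrite fvec_act.
Qed.

Lemma brcls_frame u : u \in fixv L P ->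
  brcls P u = \sum_(z in Fix) fco z u *: brcls P (fvec z).
Proof.
move=> fu; apply/eqP; rewrite -subr_eq0.
rewrite (eq_bigr (fun z => brcls P (fco z u *: fvec z))) => [|z _].
  rewrite -linear_sum -linearB brcls_eq0 ?fixv_frame //.
  rewrite rpredB // rpred_sum // => z Fz.
  by rewrite rpredZ // (fixv_fvec sPG).
by rewrite [RHS]linearZ.
Qed.

Fact brauer_frame_sum (u : B) : u = \sum_(z in Fix) brauer_co z u *: brcls P (fvec z).
Proof.
have fu := sqreprP u; rewrite {1}[u]brcls_repr brcls_frame //.
by apply: eq_bigr => z Fz; rewrite comp_lfunE.
Qed.

(** The Brauer construction of a retract of F[Z] is a retract of F[Z^P] over the normalizer of [P],
    with the coordinates and the classes of the vectors at the fixed points. *)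
Definition brauer_frame : frame B :=
  Frame brauer_frame_action brauer_frame_dom brauer_frame_co brauer_frame_vec
    brauer_frame_sum.

End FrameBrauer.

(** * Left-free coordinates from the vertex condition *)

Section InducedFrame.
Variables (F : fieldType) (gT : finGroupType) (G P : {group gT}).
Variables (sPG : P \subset G) (M : gmodule F G).

Notation I := (gind sPG (gres sPG M)).

Definition ipure (f : galg F G) (m : M) : I :=
  tpure P (rmact (galg F G)) (mact (gres sPG M)) f m.

Lemma ipure_linearl m : linear (ipure^~ m).
Proof. exact: tpure_linearl. Qed.

Lemma ipure_linearr f : linear (ipure f).
Proof. exact: tpure_linearr. Qed.

Lemma galg_actE x (f : galg F G) (y : [subg G]) :
  (mact (galg F G) x f : {ffun _ -> _}) y = f (subg G (x.1^-1 * sgval y * x.2)%g).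
Proof. by rewrite lfunE ffunE. Qed.

Lemma ipure_balanced h f m : h \in P ->
  ipure (rmact (galg F G) h f) m = ipure f (mact M h m).
Proof. exact: tpure_balanced. Qed.

Lemma ind_actE g f m : g \in G ->
  mact I g (ipure f m) = ipure (lmact (galg F G) g f) m.
Proof.
move=> Gg; rewrite /ipure [LHS]tmap_pure ?id_lfunE // => x Px.
rewrite comp_lfun1l comp_lfun1r; split=> //.
by rewrite lrmactC // (subsetP sPG).
Qed.

Lemma ind_eq (V : vectType F) (f g : I -> V) : linear f -> linear g ->
  (forall a m, f (ipure a m) = g (ipure a m)) -> f =1 g.
Proof.
move=> lf lg fg u; rewrite -(linfunK lf) -(linfunK lg).
by apply: tens_eq => a m; rewrite !linfunK //; apply: fg.
Qed.

Section Lift.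
Variables (V : vectType F) (b : galg F G -> M -> V).
Hypothesis bb : bilinear_fun b.
Hypothesis bP : {in P, forall h a m, b (rmact (galg F G) h a) m = b a (mact M h m)}.

Definition ind_lift : 'Hom(I, V) :=
  tens_lift P (rmact (galg F G)) (mact (gres sPG M)) b.

Lemma ind_liftE a m : ind_lift (ipure a m) = b a m.
Proof. exact: (@tens_liftE _ _ _ (gres sPG M)). Qed.

End Lift.

Definition gpoint (g : gT) : galg F G := point_mass F (subg G g).

Lemma galg_point g h k : g \in G -> h \in G -> k \in G ->
  mact (galg F G) (g, h) (gpoint k) = gpoint (g * k * h^-1)%g.
Proof.
move=> Gg Gh Gk; apply/ffunP=> y; rewrite galg_actE !ffunE /=; congr (nat_of_bool _)%:R.
have Gy := subgP y; apply/eqP/eqP => [e | ->].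
  have := congr1 (@sgval _ _) e; rewrite !subgK ?groupM ?groupV // => <-.
  by rewrite !mulgA mulgV mul1g mulgK sgvalK.
by rewrite subgK ?groupM ?groupV // !mulgA mulVg mul1g mulgKV.
Qed.

(** The factor [h] moves across the tensor sign and cancels; hence the vector attached to a coset
    does not depend on the element picked in it. *)
Lemma ipure_point g h m : g \in G -> h \in P ->
  ipure (gpoint (g * h)) (mact M (g * h)^-1 m) = ipure (gpoint g) (mact M g^-1 m).
Proof.
move=> Gg Ph; have Gh := subsetP sPG _ Ph.
have -> : gpoint (g * h) = rmact (galg F G) h (gpoint g).
  by rewrite [RHS]galg_point ?groupV // invgK mul1g.
rewrite ipure_balanced // mactMv ?groupV ?groupM //.
by rewrite invMg mulgA mulgV mul1g.
Qed.

Variable fr : frame M.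

Notation Z := ({set gT} * fpt fr)%type.

(** The module induced from the restriction of [M] to [P] is F[G/P] (x) M over [F], by g (x) m |->
    gP (x) g m. The points are thus pairs of a left coset and a point of [fr], with the diagonal
    action. *)
Definition ind_to (z : Z) g : Z := ((g^-1 *: z.1)%g, fto z.2 g).

(* The points outside ind_dom, whose first component is not a coset, carry junk
   values of ind_co and ind_vec. *)
Definition ind_dom : {set Z} := [set z : Z | (z.1 \in lcosets P G) && (z.2 \in fdom fr)].

(** The coordinate at [z] of the image of a (x) m in F[G/P] (x) M. *)
Definition ind_bil (z : Z) (a : galg F G) (m : M) : F^o :=
  \sum_(g in z.1 :&: G) (a : {ffun _ -> F^o}) (subg G g) *: fco z.2 (mact M g m).

Definition ind_co (z : Z) : 'Hom(I, F^o) := ind_lift (ind_bil z).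

Definition ind_vec (z : Z) : I :=
  ipure (gpoint (repr z.1)) (mact M (repr z.1)^-1 (fvec z.2)).

Lemma coset_sub C : C \in lcosets P G -> C \subset G.
Proof.
case/lcosetsP=> x Gx ->; apply/subsetP=> _ /lcosetP[y Py ->].
by rewrite groupM // (subsetP sPG).
Qed.

Lemma coset_repr C g : C \in lcosets P G -> g \in C -> C = (g *: P)%g.
Proof. by case/lcosetsP=> x Gx -> gC; apply/esym/lcoset_eqP. Qed.

Lemma repr_coset C : C \in lcosets P G -> repr C \in C.
Proof. by case/lcosetsP=> x Gx ->; apply: mem_repr (lcoset_refl P x). Qed.

Lemma ind_vecE C x g : C \in lcosets P G -> g \in C ->
  ind_vec (C, x) = ipure (gpoint g) (mact M g^-1 (fvec x)).
Proof.
move=> GC gC; have := repr_coset GC; rewrite [X in _ \in pred_of_set X](coset_repr GC gC).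
case/lcosetP=> h Ph; rewrite /ind_vec /= => ->; apply: ipure_point => //.
by rewrite (subsetP (coset_sub GC)).
Qed.

Lemma ind_bil_bilinear z : bilinear_fun (ind_bil z).
Proof.
split=> [m c a a' | a c m m']; rewrite /ind_bil scaler_sumr -big_split /=.
  by apply: eq_bigr => g _; rewrite !ffunE scalerDl scalerA.
apply: eq_bigr => g _; rewrite (linearP (mact M g)) (linearP (fco z.2)) scalerDr; congr (_ + _).
by rewrite !scalerA mulrC.
Qed.

Lemma ind_bil_balanced z : z.1 \in lcosets P G ->
  {in P, forall h a m, ind_bil z (rmact (galg F G) h a) m = ind_bil z a (mact M h m)}.
Proof.
move=> GC h Ph a m; rewrite /ind_bil (reindex_inj (mulIg h)) /=.
have Gh := subsetP sPG _ Ph.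
apply: eq_big => g.
  rewrite !inE (groupMr _ Gh); congr (_ && _).
  case/lcosetsP: GC => x Gx ->.
  by rewrite !mem_lcoset mulgA groupMr.
rewrite inE (groupMr _ Gh) => /andP[_ Gg].
by rewrite galg_actE /= invg1 mul1g subgK ?groupM // mulgK mactMv.
Qed.

Lemma ind_coE z a m : z.1 \in lcosets P G -> ind_co z (ipure a m) = ind_bil z a m.
Proof.
by move=> GC; apply: ind_liftE; [apply: ind_bil_bilinear | apply: ind_bil_balanced].
Qed.

Lemma ind_to_coset C g : g \in G ->
  ((g^-1 *: C)%g \in lcosets P G) = (C \in lcosets P G).
Proof.
have imp D k : k \in G -> D \in lcosets P G -> (k *: D)%g \in lcosets P G.
  move=> Gk /lcosetsP[x Gx ->]; rewrite -lcosetM.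
  by apply/lcosetsP; exists (k * x)%g; rewrite ?groupM.
move=> Gg; apply/idP/idP => [/(imp _ g Gg)|]; last by apply: imp; rewrite groupV.
by rewrite -lcosetM mulgV mul1g.
Qed.

Fact ind_frame_action : is_action G ind_to.
Proof.
split=> [g [C x] [D y] [eCD exy] | [C x] g h Gg Gh].
  rewrite -[C](lcosetKV g) eCD lcosetKV; congr (_, _).
  exact: (act_inj (faction fr) g).
by rewrite /ind_to /= ftoM // invMg lcosetM.
Qed.

Fact ind_frame_dom : {in G, forall g z, (ind_to z g \in ind_dom) = (z \in ind_dom)}.
Proof. by move=> g Gg z; rewrite !inE /= ind_to_coset // fdom_to. Qed.

Fact ind_frame_co : {in G & ind_dom, forall g z u,
  ind_co z (mact I g u) = ind_co (ind_to z g) u}.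
Proof.
move=> g [C x] Gg; rewrite inE /= => /andP[GC Dx].
apply: ind_eq => [c u v | c u v | a m]; rewrite ?linearP //.
rewrite ind_actE // !ind_coE ?ind_to_coset // /ind_bil /=.
rewrite (reindex_inj (mulgI g)) /=; apply: eq_big => k.
  by rewrite !inE (groupMl _ Gg) mem_lcoset invgK.
rewrite inE (groupMl _ Gg) => /andP[_ Gk].
by rewrite galg_actE /= mulg1 subgK ?groupM // mulKg -mactMv // fco_act.
Qed.

Fact ind_frame_vec : {in G & ind_dom, forall g z,
  mact I g (ind_vec (ind_to z g)) = ind_vec z}.
Proof.
move=> g [C x] Gg; rewrite inE /= => /andP[GC Dx].
set k := repr C; have Ck := repr_coset GC; have Gk := subsetP (coset_sub GC) _ Ck.
rewrite (ind_vecE _ GC Ck) (@ind_vecE _ _ (g^-1 * k)%g) ?ind_to_coset //; last first.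
  by rewrite mem_lcoset invgK mulKVg.
rewrite ind_actE // [lmact _ _ _]galg_point ?groupM ?groupV //.
rewrite invg1 mulg1 mulKVg invMg invgK -mactMv ?groupV //.
by rewrite fvec_act.
Qed.

Lemma sum_lcosets (V : nmodType) (f : gT -> V) :
  \sum_(g in G) f g = \sum_(C in lcosets P G) \sum_(g in C) f g.
Proof.
rewrite (partition_big (fun g => (g *: P)%g) (mem (lcosets P G))) /=; last first.
  by move=> g Gg; apply/lcosetsP; exists g.
apply: eq_bigr => C GC; apply: eq_bigl => g; apply/andP/idP => [[_ /eqP <-] | gC].
  exact: lcoset_refl.
by rewrite -(coset_repr GC gC) (subsetP (coset_sub GC)).
Qed.

Fact ind_frame_sum u : u = \sum_(z in ind_dom) ind_co z u *: ind_vec z.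
Proof.
have lin1 : linear (fun u => \sum_(z in ind_dom) ind_co z u *: ind_vec z).
  move=> c v w; rewrite scaler_sumr -big_split; apply: eq_bigr => z _.
  by rewrite linearP scalerDl scalerA.
apply: (ind_eq _ lin1) u => // a m.
transitivity (\sum_(g in G) (a : {ffun _ -> F^o}) (subg G g) *: ipure (gpoint g) m).
  have {1}-> : a = \sum_(g in G) (a : {ffun _ -> F^o}) (subg G g) *: gpoint g.
    rewrite {1}[a](ffun_point_mass (a : {ffun _ -> F^o})).
    rewrite [RHS](reindex_onto (@sgval _ G) (subg G)) /=; last exact: subgK.
    by apply: eq_big => x; rewrite /gpoint sgvalK ?subgP ?eqxx.
  rewrite (lin_sum _ _ _ (ipure_linearl m)); apply: eq_bigr => g _.
  by rewrite (lin_scale _ _ (ipure_linearl m)).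
rewrite sum_lcosets.
rewrite (eq_bigl (fun z : Z => (z.1 \in lcosets P G) && (z.2 \in fdom fr))); last first.
  by move=> z; rewrite inE.
rewrite -(pair_big (mem (lcosets P G)) (mem (fdom fr))
  (fun C x => ind_co (C, x) (ipure a m) *: ind_vec (C, x))) /=.
apply: eq_bigr => C GC.
transitivity (\sum_(x in fdom fr) \sum_(g in C) ((a : {ffun _ -> F^o}) (subg G g)
    *: fco x (mact M g m)) *: ipure (gpoint g) (mact M g^-1 (fvec x))).
  rewrite exchange_big; apply: eq_bigr => g gC.
  have Gg := subsetP (coset_sub GC) _ gC.
  (* Expanding g m rather than m in [fr] produces the vectors g (x) g^-1 [fvec x], which are those
     of the induced frame at the coset of g. *)
  have {1}-> : m = mact M g^-1 (mact M g m).
    by rewrite mactMv ?groupV // mulVg mact1 id_lfunE.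
  rewrite {1}[mact M g m](frame_sum fr) linear_sum /=.
  rewrite (lin_sum _ _ _ (ipure_linearr _)) scaler_sumr; apply: eq_bigr => x _.
  by rewrite linearZ (lin_scale _ _ (ipure_linearr _)) scalerA.
apply: eq_bigr => x Dx; rewrite ind_coE // scaler_suml /=.
rewrite (setIidPl (coset_sub GC)); apply: eq_bigr => g gC.
by rewrite (ind_vecE _ GC gC).
Qed.

Definition ind_frame : frame I :=
  Frame ind_frame_action ind_frame_dom ind_frame_co ind_frame_vec ind_frame_sum.

(** The maps are m |-> 1 (x) m and a (x) m |-> a m. They show that [M] is projective relative to
    [G], from which the search for a vertex starts. *)
Lemma retract_gind : (P :=: G)%g -> retract M I.
Proof.
move=> ePG; have b0 : bilinear_fun (fun (a : galg F G) (m : M) =>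
    \sum_(g in G) (a : {ffun _ -> F^o}) (subg G g) *: mact M g m).
  split=> [m c a a' | a c m m']; rewrite scaler_sumr -big_split /=.
    by apply: eq_bigr => g _; rewrite !ffunE scalerDl scalerA.
  apply: eq_bigr => g _; rewrite linearP scalerDr; congr (_ + _).
  by rewrite !scalerA mulrC.
set b := (fun _ _ => _) in b0.
have bP : {in P, forall h a m, b (rmact (galg F G) h a) m = b a (mact M h m)}.
  move=> h; rewrite ePG => Gh a m; rewrite /b (reindex_inj (mulIg h)) /=.
  apply: eq_big => g; first by rewrite (groupMr _ Gh).
  rewrite (groupMr _ Gh) => Gg.
  by rewrite galg_actE /= invg1 mul1g subgK ?groupM // mulgK mactMv.
have lI := ipure_linearr (gpoint 1).
exists (linfun (ipure (gpoint 1))), (ind_lift b); split=> [g Gg m | g Gg | m].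
- rewrite !(linfunK lI) ind_actE // -ipure_balanced ?ePG //.
  by rewrite !galg_point ?groupV // invgK invg1 !mulg1 !mul1g.
- pose f1 (u : I) := ind_lift b (mact I g u); pose f2 u := mact M g (ind_lift b u).
  apply: (@ind_eq _ f1 f2) => [c u v | c u v | a m]; rewrite /f1 /f2 ?linearP //.
  rewrite ind_actE // !ind_liftE // /b linear_sum (reindex_inj (mulgI g)) /=.
  apply: eq_big => k; first by rewrite (groupMl _ Gg).
  rewrite (groupMl _ Gg) => Gk; rewrite linearZ /=.
  by rewrite galg_actE /= mulg1 subgK ?groupM // mulKg mactMv.
- rewrite (linfunK lI) ind_liftE // /b (bigD1 1%g) //= big1 => [|g /andP[Gg g1]].
    by rewrite !ffunE eqxx scale1r mact1 id_lfunE addr0.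
  rewrite !ffunE; case: eqP => [e|_]; last by rewrite scale0r.
  by case/eqP: g1; have := congr1 (@sgval _ _) e; rewrite !subgK.
Qed.

End InducedFrame.

(** * Decomposition into indecomposables, existence of vertices *)

Section Submodule.
Variables (F : fieldType) (gT : finGroupType) (G : {group gT}).
Variables (M : gmodule F G) (A : {vspace M}) (stA : gstable A).

Definition gsub_act (g : gT) : 'End(subvs_of A) :=
  (linfun (vsproj A) \o (mact M g \o linfun vsval))%VF.

Lemma gsub_actE g u : g \in G -> vsval (gsub_act g u) = mact M g (vsval u).
Proof.
move=> Gg; rewrite !comp_lfunE !lfunE /= vsprojK //.
by apply: subvP (stA Gg) _ (memv_img _ (subvsP u)).
Qed.

Fact gsub_act1 : gsub_act 1 = \1%VF.
Proof.
by apply/lfunP=> u; apply: subvs_inj; rewrite [LHS]gsub_actE // mact1 !id_lfunE.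
Qed.

Fact gsub_actM : {in G &, forall g h, gsub_act (g * h)%g = (gsub_act g \o gsub_act h)%VF}.
Proof.
move=> g h Gg Gh; apply/lfunP=> u; apply: subvs_inj.
by rewrite [LHS]gsub_actE ?groupM // comp_lfunE [RHS]gsub_actE // gsub_actE // mactMv.
Qed.

Definition gsub : gmodule F G := GModule gsub_act1 gsub_actM.

Definition gsub_inj : 'Hom(gsub, M) := linfun vsval.

Lemma gsub_injE u : gsub_inj u = vsval u.
Proof. exact: lfunE. Qed.

Lemma gsub_inj_hom : gmod_hom gsub_inj.
Proof. by move=> g Gg u; rewrite !gsub_injE; apply: gsub_actE. Qed.

End Submodule.

Section Decomposition.
Variables (F : fieldType) (gT : finGroupType) (G : {group gT}).
Implicit Types L M : gmodule F G.

Definition biproduct L L1 L2 : Prop :=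
  exists (i1 : 'Hom(L1, L)) (p1 : 'Hom(L, L1)) (i2 : 'Hom(L2, L)) (p2 : 'Hom(L, L2)),
    [/\ gmod_hom i1 /\ gmod_hom p1, gmod_hom i2 /\ gmod_hom p2,
        cancel i1 p1, cancel i2 p2 & forall u, u = i1 (p1 u) + i2 (p2 u)].

Lemma biproduct_gsub M (A B : {vspace M}) (stA : gstable A) (stB : gstable B) :
  (A + B = fullv)%VS -> (A :&: B = 0)%VS -> biproduct M (gsub stA) (gsub stB).
Proof.
move=> fAB dAB; have dBA : (B :&: A = 0)%VS by rewrite capvC.
have decM u : u = daddv_pi A B u + daddv_pi B A u.
  by rewrite daddv_pi_add // fAB memvf.
have hpi (C D : {vspace M}) : gstable C -> gstable D ->
    (forall u, u = daddv_pi C D u + daddv_pi D C u) ->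
    (C :&: D = 0)%VS ->
    {in G, forall g u, daddv_pi C D (mact M g u) = mact M g (daddv_pi C D u)}.
  move=> stC stD dec dCD g Gg u; rewrite {1}[u]dec linearD /= daddv_piD //.
    by apply: subvP (stC g Gg) _ (memv_img _ (memv_pi _ _ _)).
  by apply: subvP (stD g Gg) _ (memv_img _ (memv_pi _ _ _)).
have decM' u : u = daddv_pi B A u + daddv_pi A B u by rewrite addrC.
pose pr C D : 'Hom(M, subvs_of C) := (linfun (vsproj C) \o daddv_pi C D)%VF.
have prE C D u : vsval (pr C D u) = daddv_pi C D u.
  by rewrite comp_lfunE lfunE /= vsprojK ?memv_pi.
exists (gsub_inj stA), (pr A B), (gsub_inj stB), (pr B A); split=> [||u|u|u].
- split=> [|g Gg u]; first exact: gsub_inj_hom.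
  by apply: subvs_inj; rewrite [LHS]prE [RHS]gsub_actE // prE hpi.
- split=> [|g Gg u]; first exact: gsub_inj_hom.
  by apply: subvs_inj; rewrite [LHS]prE [RHS]gsub_actE // prE hpi.
- by apply: subvs_inj; rewrite [LHS]prE gsub_injE daddv_pi_id ?subvsP.
- by apply: subvs_inj; rewrite [LHS]prE gsub_injE daddv_pi_id ?subvsP.
- by rewrite !gsub_injE !prE -decM.
Qed.

Lemma retract_refl M : retract M M.
Proof.
by exists \1%VF, \1%VF; split=> [g Gg m | g Gg m | m]; rewrite !id_lfunE.
Qed.

(** Induction on the dimension: by classical logic, a module that is neither zero nor indecomposable
    splits into two stable subspaces of smaller dimension, and the retracts of these are retracts of
    [M]. *)
Lemma indecomposable_ind (Q : gmodule F G -> Prop) :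
  (forall L, (fullv : {vspace L}) = 0%VS -> Q L) ->
  (forall L L1 L2, biproduct L L1 L2 -> Q L1 -> Q L2 -> Q L) ->
  forall M, (forall L, indecomposable L -> retract L M -> Q L) -> Q M.
Proof.
move=> Q0 QD M; have [n] := ubnP (\dim (fullv : {vspace M})).
elim: n M => // n IH M dM QM; have [/Q0//|M0] := eqVneq (fullv : {vspace M}) 0%VS.
have [indM | ndM] := classic (indecomposable M).
  exact/QM/retract_refl.
suff [A [B [stA [stB [fAB dAB [A0 B0]]]]]] : exists A B : {vspace M},
    gstable A /\ gstable B /\ [/\ (A + B = fullv)%VS, (A :&: B = 0)%VS &
     A <> 0%VS /\ B <> 0%VS].
  have bi := biproduct_gsub stA stB fAB dAB.
  have dAB' : (\dim A + \dim B)%N = \dim (fullv : {vspace M}).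
    by rewrite -fAB dimv_disjoint_sum.
  have posd (C : {vspace M}) : C <> 0%VS -> (0 < \dim C)%N.
    by move=> C0; rewrite lt0n dimv_eq0; apply/eqP.
  have dsub (C : {vspace M}) (stC : gstable C) :
      \dim (fullv : {vspace (gsub stC)}) = \dim C by rewrite dimvf.
  apply: QD bi _ _; apply: IH; rewrite ?dsub.
  - by rewrite -ltnS (leq_trans _ dM) // ltnS -dAB' -addn1 leq_add2l posd.
  - move=> L iL rL; apply: QM => //; apply: retract_trans rL _.
    case: (biproduct_gsub stA stB fAB dAB) => i1 [p1 [i2 [p2 [[h1 h1'] _ c1 _ _]]]].
    by exists i1, p1.
  - by rewrite -ltnS (leq_trans _ dM) // ltnS -dAB' -addn1 addnC leq_add2r posd.
  - move=> L iL rL; apply: QM => //; apply: retract_trans rL _.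
    case: (biproduct_gsub stA stB fAB dAB) => i1 [p1 [i2 [p2 [_ [h2 h2'] _ c2 _]]]].
    by exists i2, p2.
apply: NNPP => nAB; case: ndM; split=> [|A B stA stB fAB dAB]; first exact/eqP.
have [->|A0] := eqVneq A 0%VS; first by left.
have [->|B0] := eqVneq B 0%VS; first by right.
by case: nAB; exists A, B; do 3!split=> //; split; apply/eqP.
Qed.

(** Descent on the order, starting from [G], relative to which every module is projective. *)
Lemma vertex_exists M : exists P, vertex M P.
Proof.
suff: forall P : {group gT}, rel_projective M P -> exists P, vertex M P.
  apply; exists (subxx G); apply: retract_isom_to_summand.
  exact: (@retract_gind _ _ _ G).
move=> P; have [n] := ubnP #|P|; elim: n P => // n IH P cP rP.
have [[Q [prQP rQ]] | nQ] := classic (exists Q : {group gT}, Q \proper P /\ rel_projective M Q).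
  by apply: (IH Q) => //; rewrite (leq_trans (proper_card prQP)).
by exists P; split=> // Q prQP rQ; apply: nQ; exists Q.
Qed.

End Decomposition.

Section ZeroFrame.
Variables (F : fieldType) (gT : finGroupType) (G : {group gT}) (L : gmodule F G).
Hypothesis L0 : (fullv : {vspace L}) = 0%VS.

Let zero_to (z : unit) (g : gT) := z.

Fact zero_frame_action : is_action G zero_to.
Proof. by split=> [g z1 z2|]. Qed.

Fact zero_frame_dom : {in G, forall g z, (zero_to z g \in set0) = (z \in set0)}.
Proof. by []. Qed.

Fact zero_frame_co : {in G & set0, forall g (z : unit) u,
  (0 : 'Hom(L, F^o)) (mact L g u) = (0 : 'Hom(L, F^o)) u}.
Proof. by move=> g z _; rewrite inE. Qed.

Fact zero_frame_vec : {in G & set0, forall g (z : unit), mact L g 0 = 0}.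
Proof. by move=> g z _; rewrite inE. Qed.

Fact zero_frame_sum (u : L) :
  u = \sum_(z in (set0 : {set unit})) (0 : 'Hom(L, F^o)) u *: 0.
Proof. by rewrite big_set0; apply/eqP; rewrite -memv0 -L0 memvf. Qed.

Definition zero_frame : frame L :=
  @Frame _ _ _ L unit zero_to set0 (fun=> 0) (fun=> 0) zero_frame_action
    zero_frame_dom zero_frame_co zero_frame_vec zero_frame_sum.

End ZeroFrame.

(** * Frames with a free action of the left group *)

Section LeftFree.
Variables (F : fieldType) (gT hT : finGroupType).
Variables (G : {group gT}) (H : {group hT}).
Implicit Types L M : bimodule F G H.

Definition left_free L (fr : frame L) : Prop :=
  {in G & fdom fr, forall g z, fto z (g, 1%g) = z -> g = 1%g}.

(** If (g, 1) fixes the coset yP, then y^-1 (g, 1) y lies in the graph [P]; its second component is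
    1, hence so is the first. *)
Lemma ind_frame_left_free M (fr : frame M) (P : {group gT * hT})
    (sPG : P \subset setX_group G H) :
  in_lhd G H P -> left_free (ind_frame sPG fr).
Proof.
case=> U [V [a [sUG sVH eP]]] g [C x] Gg; rewrite inE /= => /andP[GC _] [eC _].
have Cr := repr_coset GC; set y := repr C in Cr.
have : y \in ((g, 1%g)^-1 *: C)%g by rewrite eC.
rewrite mem_lcoset invgK (coset_repr GC Cr) mem_lcoset.
rewrite eP => /imsetP[v Vv e].
have [e1 e2] := (congr1 fst e, congr1 snd e); rewrite /= in e1 e2.
move: e2; rewrite mul1g mulVg => v1; move: e1; rewrite -v1 epi1 => /eqP.
by rewrite -eq_mulVg1 -{1}[_.1]mul1g => /eqP/mulIg.
Qed.

(** Left-freeness passes to direct sums, so indecomposable summands [L] suffice. Such an [L] is a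
    retract of the module induced from its restriction to a vertex, and the frame induced there is
    left-free because the vertex is a graph. *)
Lemma left_free_frame M : p_permutation M ->
  (forall L, indecomposable L -> isom_to_summand L M ->
     forall P, vertex L P -> in_lhd G H P) ->
  exists fr : frame M, left_free fr.
Proof.
case=> X [to /isom_to_summand_retract [f [s [hf hs sK]]]] vertM.
pose frM := retract_frame hf hs sK (perm_frame F to).
apply: (@indecomposable_ind _ _ _ (fun L => exists fr : frame L, left_free fr)) => [L L0 | L L1 L2 | L indL rL].
- by exists (zero_frame L0) => g z _; rewrite inE.
- case=> i1 [p1 [i2 [p2 [[h1 h1'] [h2 h2'] _ _ dec]]]] [fr1 lf1] [fr2 lf2].
  exists (sum_frame h1 h1' h2 h2' dec fr1 fr2) => g [x|y] Gg; rewrite inE /=.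
    by move=> Dx [/lf1->].
  by move=> Dy [/lf2->].
have [P vP] := vertex_exists L.
have lP := vertM L indL (retract_isom_to_summand rL) P vP.
case: vP => [[sPG /isom_to_summand_retract [f' [s' [hf' hs' sK']]]] _].
case: rL => f'' [s'' [hf'' hs'' sK'']].
(* This frame comes from the permutation module and need not be free; it supplies the second
   components of the points of the induced frame. *)
have frL := retract_frame hf'' hs'' sK'' frM.
exists (retract_frame hf' hs' sK' (ind_frame sPG frL)).
exact: (ind_frame_left_free (fr := frL)).
Qed.

End LeftFree.

(** * Coordinates on a tensor product over H *)

Section TensorBimoduleTheory.
Variables (F : fieldType) (gT hT kT : finGroupType).
Variables (G : {group gT}) (H : {group hT}) (K : {group kT}).
Variables (M : bimodule F G H) (N : bimodule F H K).

Lemma bpure_balanced h (m : M) (n : N) : h \in H ->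
  bpure (rmact M h m) n = bpure m (lmact N h n).
Proof. exact: tpure_balanced. Qed.

Lemma btens_actE g (m : M) (n : N) : g \in setX_group G K ->
  mact (btens M N) g (bpure m n) = bpure (lmact M g.1 m) (rmact N g.2^-1 n).
Proof. by move=> Gg; apply: (tmap_pure _ _ (btens_balanced M N Gg)). Qed.

Lemma bpure_linearl (n : N) : linear (fun m : M => bpure m n).
Proof. exact: tpure_linearl. Qed.

Lemma bpure_linearr (m : M) : linear (fun n : N => bpure m n).
Proof. exact: tpure_linearr. Qed.

Lemma btens_eq (V : vectType F) (f g : btens M N -> V) : linear f -> linear g ->
  (forall m n, f (bpure m n) = g (bpure m n)) -> f =1 g.
Proof.
move=> lf lg fg u; rewrite -(linfunK lf) -(linfunK lg).
by apply: tens_eq => m n; rewrite !linfunK //; apply: fg.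
Qed.

Definition btens_lift (V : vectType F) (b : M -> N -> V) : 'Hom(btens M N, V) :=
  tens_lift H (rmact M) (lmact N) b.

Lemma btens_liftE (V : vectType F) (b : M -> N -> V) m n : bilinear_fun b ->
  {in H, forall h m n, b (rmact M h m) n = b m (lmact N h n)} ->
  btens_lift b (bpure m n) = b m n.
Proof. exact: tens_liftE. Qed.

End TensorBimoduleTheory.

Section TensorFrame.
Variables (F : fieldType) (gT hT kT : finGroupType).
Variables (G : {group gT}) (H : {group hT}) (K : {group kT}).
Variables (M : bimodule F G H) (N : bimodule F H K).
Variables (fr1 : frame M) (fr2 : frame N).
Hypothesis free2 : left_free fr2.

Notation XY := (fpt fr1 * fpt fr2)%type.
Implicit Types (z : XY) (S : {set XY}).

(** [H] acts on pairs through both inner factors, by a right action as in [frame]; its orbits in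
    [pair_dom] are the points of X x_H Y, on which G x K acts through [outer_to]. *)
Definition mid_to z (h : hT) : XY := (fto z.1 (1%g, h), fto z.2 (h, 1%g)).
Definition outer_to z (g : gT * kT) : XY := (fto z.1 (g.1, 1%g), fto z.2 (1%g, g.2)).
Definition pair_dom : {set XY} := setX (fdom fr1) (fdom fr2).

Lemma pair_domP z : z \in pair_dom -> z.1 \in fdom fr1 /\ z.2 \in fdom fr2.
Proof. by case: z => x y /setXP. Qed.

Lemma mulX1r (aT bT : finGroupType) (h h' : bT) :
  ((1, h * h') = (1, h) * (1, h') :> aT * bT)%g.
Proof. by congr (_, _); rewrite mulg1. Qed.

Lemma mulX1l (aT bT : finGroupType) (g g' : aT) :
  ((g * g', 1) = (g, 1) * (g', 1) :> aT * bT)%g.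
Proof. by congr (_, _); rewrite mulg1. Qed.

Lemma inX1r (aT bT : finGroupType) (A : {group aT}) (B : {group bT}) h :
  h \in B -> (1%g, h) \in setX_group A B.
Proof. by move=> Bh; rewrite inE /= group1. Qed.

Lemma inX1l (aT bT : finGroupType) (A : {group aT}) (B : {group bT}) g :
  g \in A -> (g, 1%g) \in setX_group A B.
Proof. by move=> Ag; rewrite inE /= group1 Ag. Qed.

Fact mid_action_subproof : is_action H mid_to.
Proof.
split=> [h [x y] [x' y'] [] | [x y] h h' Hh Hh'].
  by move=> /(act_inj (faction fr1)) -> /(act_inj (faction fr2)) ->.
by rewrite /mid_to /= mulX1r mulX1l !ftoM ?inX1r ?inX1l.
Qed.

Fact outer_action_subproof : is_action (setX_group G K) outer_to.
Proof.
split=> [g [x y] [x' y'] [] | [x y] [g k] [g' k']].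
  by move=> /(act_inj (faction fr1)) -> /(act_inj (faction fr2)) ->.
case/setXP=> Gg Kk /setXP[Gg' Kk'].
by rewrite /outer_to /= mulX1r mulX1l !ftoM ?inX1r ?inX1l.
Qed.

Definition mid_action := Action mid_action_subproof.
Definition outer_action := Action outer_action_subproof.

Definition mid_orbit z : {set XY} := orbit mid_action H z.

Lemma mid_orbitP z z' : reflect (exists2 h, h \in H & mid_to z h = z') (z' \in mid_orbit z).
Proof. by apply: (iffP imsetP) => -[h Hh e]; exists h. Qed.

Lemma mid_orbit_id z : z \in mid_orbit z.
Proof. by apply/mid_orbitP; exists 1%g; rewrite ?group1 //; apply: (act1 mid_action). Qed.

Lemma mid_orbit_eq z z' : z' \in mid_orbit z -> mid_orbit z' = mid_orbit z.
Proof. by move=> zz'; apply/orbit_in_eqP. Qed.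

Lemma mid_dom h z : h \in H -> (mid_to z h \in pair_dom) = (z \in pair_dom).
Proof. by move=> Hh; rewrite !inE /= !fdom_to ?inX1r ?inX1l. Qed.

Lemma outer_dom g z : g \in setX_group G K ->
  (outer_to z g \in pair_dom) = (z \in pair_dom).
Proof. by case: g => g k /setXP[Gg Kk]; rewrite !inE /= !fdom_to ?inX1r ?inX1l. Qed.

Lemma midM z h h' : h \in H -> h' \in H -> mid_to z (h * h') = mid_to (mid_to z h) h'.
Proof. by move=> Hh Hh'; apply: (actMin mid_action). Qed.

Lemma mid_outerC z g h : g \in setX_group G K -> h \in H ->
  mid_to (outer_to z g) h = outer_to (mid_to z h) g.
Proof.
case: g => g k /setXP[Gg Kk] Hh; rewrite /mid_to /outer_to /=.
rewrite -!ftoM ?inX1r ?inX1l //; congr (fto _ (_, _), fto _ (_, _));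
  by rewrite mul1g mulg1.
Qed.

(** The second component of a pair is moved freely, by [free2]. *)
Lemma mid_free z : z \in pair_dom -> {in H &, injective (mid_to z)}.
Proof.
case/pair_domP=> _ Dy h h' Hh Hh' [_ e].
have: fto z.2 ((h, 1) * (h', 1)^-1)%g = z.2.
  by rewrite ftoM ?groupV ?inX1l // e ftoK ?inX1l.
have -> : ((h, 1) * (h', 1)^-1 = (h * h'^-1, 1) :> hT * kT)%g.
  by congr (_, _); rewrite mul1g; apply: invg1.
move/(free2 _ Dy); rewrite groupM ?groupV // => /(_ isT)/eqP.
by rewrite -eq_mulgV1 => /eqP.
Qed.

(** The coordinate of m (x) n at the orbit of [z]. For [z] in [pair_dom], where [H] acts freely,
    this is the sum over the orbit of the products of coordinates. *)
Definition theta z (m : M) (n : N) : F^o :=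
  \sum_(h in H) (fco (mid_to z h).1 m : F) *: (fco (mid_to z h).2 n : F^o).

Lemma theta_bilinear z : bilinear_fun (theta z).
Proof.
split=> [n c m m' | m c n n']; rewrite /theta scaler_sumr -big_split /=.
  by apply: eq_bigr => h _; rewrite linearP scalerDl scalerA.
apply: eq_bigr => h _; rewrite (linearP (fco _)) scalerDr; congr (_ + _).
by rewrite !scalerA mulrC.
Qed.

Lemma theta_balanced z : z \in pair_dom ->
  {in H, forall k m n, theta z (rmact M k m) n = theta z m (lmact N k n)}.
Proof.
case/pair_domP=> Dx Dy k Hk m n; rewrite /theta (reindex_inj (mulIg k)) /=.
apply: eq_big => h; rewrite groupMr // => Hh.
rewrite /rmact /lmact !fco_act ?fdom_to ?inX1r ?inX1l ?groupV ?groupM //.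
by rewrite -!ftoM ?inX1r ?inX1l ?groupV ?groupM // -mulX1r -mulX1l mulgK.
Qed.

Lemma theta_mid z h m n : h \in H -> theta (mid_to z h) m n = theta z m n.
Proof.
move=> Hh; rewrite /theta [RHS](reindex_inj (mulgI h)); apply: eq_big => k.
  by rewrite groupMl.
by move=> Hk; rewrite (midM z Hh Hk).
Qed.

Definition tco z : 'Hom(btens M N, F^o) := btens_lift (theta z).

Lemma tcoE z m n : z \in pair_dom -> tco z (bpure m n) = theta z m n.
Proof.
by move=> Dz; apply: btens_liftE; [apply: theta_bilinear | apply: theta_balanced].
Qed.

Lemma tco_mid z h u : z \in pair_dom -> h \in H -> tco (mid_to z h) u = tco z u.
Proof.
move=> Dz Hh; move: u; apply: btens_eq => [c u v | c u v | m n]; rewrite ?linearP //.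
by rewrite !tcoE ?mid_dom ?theta_mid.
Qed.

Lemma tco_outer z g u : z \in pair_dom -> g \in setX_group G K ->
  tco z (mact (btens M N) g u) = tco (outer_to z g) u.
Proof.
move=> Dz Gg; move: u; apply: btens_eq => [c u v | c u v | m n]; rewrite ?linearP //.
rewrite btens_actE // !tcoE ?outer_dom //; apply: eq_bigr => h Hh.
rewrite mid_outerC //; case: g Gg => g k /setXP[Gg Kk]; case/pair_domP: Dz => Dx Dy.
by rewrite /rmact /lmact !fco_act ?fdom_to ?invgK ?inX1r ?inX1l.
Qed.

Definition pvec z : btens M N := bpure (fvec z.1) (fvec z.2).

Lemma pvec_mid z h : z \in pair_dom -> h \in H -> pvec (mid_to z h) = pvec z.
Proof.
case/pair_domP=> Dx Dy Hh; rewrite /pvec /=.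
have -> : fvec (fto z.1 (1%g, h)) = rmact M h (fvec z.1).
  have e1 : ((1, h) = (1, h^-1)^-1 :> gT * hT)%g by congr (_, _); rewrite ?invg1 ?invgK.
  by rewrite [in LHS]e1 -fvec_actV ?inX1r ?groupV.
rewrite bpure_balanced // /lmact fvec_act ?inX1l //.
Qed.

Lemma pvec_outer z g : z \in pair_dom -> g \in setX_group G K ->
  mact (btens M N) g (pvec (outer_to z g)) = pvec z.
Proof.
move=> /pair_domP[Dx Dy] Gg; rewrite btens_actE //.
case: g Gg => g k /setXP[Gg Kk].
by rewrite /rmact /lmact /= invgK !fvec_act ?inX1r ?inX1l.
Qed.

(* The points of the frame are the H-orbits of pairs; tens_co and tens_vec do
   not depend on the pair picked in an orbit, and are 0 at the empty set. *)
Definition tens_co S : 'Hom(btens M N, F^o) :=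
  if [pick z in S] is Some z then tco z else 0.

Definition tens_vec S : btens M N :=
  if [pick z in S] is Some z then pvec z else 0.

Lemma tens_coE z u : z \in pair_dom -> tens_co (mid_orbit z) u = tco z u.
Proof.
move=> Dz; rewrite /tens_co; case: pickP => [z' /mid_orbitP[h Hh <-] | /(_ z)].
  exact: tco_mid.
by rewrite mid_orbit_id.
Qed.

Lemma tens_vecE z : z \in pair_dom -> tens_vec (mid_orbit z) = pvec z.
Proof.
move=> Dz; rewrite /tens_vec; case: pickP => [z' /mid_orbitP[h Hh <-] | /(_ z)].
  exact: pvec_mid.
by rewrite mid_orbit_id.
Qed.

Definition tens_to S (g : gT * kT) : {set XY} := [set outer_to z g | z in S].

Definition tens_dom : {set {set XY}} := [set mid_orbit z | z in pair_dom].

Lemma tens_to_orbit z g : g \in setX_group G K ->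
  tens_to (mid_orbit z) g = mid_orbit (outer_to z g).
Proof.
move=> Gg; apply/setP=> z'; apply/imsetP/mid_orbitP.
  by case=> _ /mid_orbitP[h Hh <-] ->; exists h; rewrite ?mid_outerC.
case=> h Hh <-; exists (mid_to z h); rewrite ?mid_outerC //.
by apply/mid_orbitP; exists h.
Qed.

Fact tens_frame_action : is_action (setX_group G K) tens_to.
Proof. exact: (setact_is_action outer_action). Qed.

Fact tens_frame_dom :
  {in setX_group G K, forall g S, (tens_to S g \in tens_dom) = (S \in tens_dom)}.
Proof.
have imp g S : g \in setX_group G K -> S \in tens_dom -> tens_to S g \in tens_dom.
  move=> Gg /imsetP[z Dz ->]; rewrite tens_to_orbit //.
  by apply: imset_f; rewrite outer_dom.
move=> g Gg S; apply/idP/idP; last exact: imp.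
move/(imp g^-1%g _ (groupVr Gg)).
by rewrite -[tens_to _ _](actMin (Action tens_frame_action)) ?groupV // mulgV
  [X in X \in _](act1 (Action tens_frame_action)).
Qed.

Fact tens_frame_co : {in setX_group G K & tens_dom, forall g S u,
  tens_co S (mact (btens M N) g u) = tens_co (tens_to S g) u}.
Proof.
move=> g _ Gg /imsetP[z Dz ->] u.
by rewrite tens_to_orbit // !tens_coE ?outer_dom // tco_outer.
Qed.

Fact tens_frame_vec : {in setX_group G K & tens_dom, forall g S,
  mact (btens M N) g (tens_vec (tens_to S g)) = tens_vec S}.
Proof.
move=> g _ Gg /imsetP[z Dz ->].
by rewrite tens_to_orbit // !tens_vecE ?outer_dom // pvec_outer.
Qed.

Lemma acts_pair_dom : [acts H, on pair_dom | mid_action].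
Proof.
apply/subsetP=> h Hh; rewrite !inE Hh /=.
by apply/subsetP=> z Dz; rewrite inE /= mid_dom.
Qed.

Fact tens_frame_sum u : u = \sum_(S in tens_dom) tens_co S u *: tens_vec S.
Proof.
pose g (v : btens M N) := \sum_(S in tens_dom) tens_co S v *: tens_vec S.
have lin : linear g.
  move=> c v w; rewrite /g scaler_sumr -big_split; apply: eq_bigr => z _.
  by rewrite linearP scalerDl scalerA.
apply: (btens_eq (f := id) _ lin) u => // m n; rewrite /g.
transitivity (\sum_(z in pair_dom) (fco z.1 m * fco z.2 n : F) *: pvec z).
  rewrite {1}[m](frame_sum fr1) (lin_sum _ _ _ (bpure_linearl _)).
  rewrite (eq_bigl (fun z : XY => (z.1 \in fdom fr1) && (z.2 \in fdom fr2))); last first.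
    by case=> x y; rewrite in_setX.
  rewrite -(pair_big (mem (fdom fr1)) (mem (fdom fr2))
    (fun x y => (fco x m * fco y n : F) *: pvec (x, y))) /=.
  apply: eq_bigr => x _; rewrite (lin_scale _ _ (bpure_linearl _)).
  rewrite {1}[n](frame_sum fr2) (lin_sum _ _ _ (bpure_linearr _)) scaler_sumr.
  apply: eq_bigr => y _; rewrite (lin_scale _ _ (bpure_linearr _)) scalerA.
  by [].
rewrite (sum_orbits acts_pair_dom); apply: eq_bigr => _ /imsetP[z Dz ->].
rewrite -/(mid_orbit z) tens_coE // tens_vecE // tcoE // /theta scaler_suml.
(* Freeness turns the sum over the orbit of [z] into the sum over [H] that defines [theta]. *)
rewrite /mid_orbit /orbit big_imset /=; last exact: mid_free.
by apply: eq_bigr => h Hh; rewrite pvec_mid.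
Qed.

Definition tens_frame : frame (btens M N) :=
  Frame tens_frame_action tens_frame_dom tens_frame_co tens_frame_vec
    tens_frame_sum.

Lemma tco_inj u : {in pair_dom, forall z, tco z u = 0} -> u = 0.
Proof.
move=> u0; rewrite [u]tens_frame_sum big1 // => _ /imsetP[z Dz ->].
by rewrite tens_coE // u0 // scale0r.
Qed.

End TensorFrame.

(** * The triples (alpha, V, beta) *)

Lemma morph_im_pgroup (aT bT : finGroupType) (p : nat) (V : {group bT}) (f : bT -> aT) :
  {in V &, {morph f : x y / (x * y)%g}} -> (p.-group V)%g -> (p.-group (f @: V))%g.
Proof.
move=> fM pV; have := morphim_pgroup (Morphism fM) pV.
by rewrite morphimEdom.
Qed.

Section Graphs.
Variables (aT bT : finGroupType).

Lemma epi_pgroup (p : nat) (U : {group aT}) (V : {group bT}) (a : epi U V) :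
  (p.-group V)%g -> (p.-group U)%g.
Proof.
move=> pV; have /and3P[_ _ /eqP <-] := valP a.
by apply: morph_im_pgroup pV; apply: epiM.
Qed.

Lemma lhd_pgroup (p : nat) (U : {group aT}) (V : {group bT}) (a : epi U V) :
  (p.-group V)%g -> (p.-group (lhd a))%g.
Proof.
move=> pV; apply: (@morph_im_pgroup _ _ p V (fun v => (a v, v))) pV => v w Vv Vw.
by rewrite epiM.
Qed.

Lemma mem_lhd (U : {group aT}) (V : {group bT}) (a : epi U V) v :
  v \in V -> (a v, v) \in lhd a.
Proof. by move=> Vv; apply/imsetP; exists v. Qed.

Lemma epi_surj (U : {group aT}) (V : {group bT}) (a : epi U V) u :
  u \in U -> exists2 v, v \in V & u = a v.
Proof.
have /and3P[_ _ /eqP <-] := valP a.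
by case/imsetP=> v Vv ->; exists v.
Qed.

Lemma epi_out (U : {group aT}) (V : {group bT}) (a : epi U V) v :
  v \notin V -> a v = 1%g.
Proof.
by have /and3P[_ /forallP/(_ v)/implyP a1 _] := valP a => /a1/eqP.
Qed.

(** Two elements of [S] over the same v differ by some (a, 1) in [S], so the element picked over v
    is unique, and uniqueness makes the picked map multiplicative. The value 1 outside [V] is the
    convention of [epi]. *)
Lemma graph_hom (S : {group aT * bT}) (V : {group bT}) :
  (forall a, (a, 1%g) \in S -> a = 1%g) ->
  {in V, forall v, exists a, (a, v) \in S} ->
  exists f : {ffun bT -> aT},
    [/\ morphic V f, forall v, v \notin V -> f v = 1%g & {in V, forall v, (f v, v) \in S}].
Proof.
move=> S1 SV.
pose f := [ffun v => if v \in V then odflt 1%g [pick a | (a, v) \in S] else 1%g].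
have fS : {in V, forall v, (f v, v) \in S}.
  move=> v Vv; rewrite ffunE Vv; case: pickP => //= nS.
  by have [a aS] := SV v Vv; have := nS a; rewrite /= aS.
exists f; split=> //; last by move=> v nVv; rewrite ffunE (negPf nVv).
apply/morphicP=> v w Vv Vw; apply/eqP; rewrite eq_mulgV1; apply/eqP/S1.
rewrite -(mulgV (v * w)%g).
exact: groupM (fS _ (groupM Vv Vw)) (groupVr (groupM (fS _ Vv) (fS _ Vw))).
Qed.

End Graphs.

Section GammaTheory.
Variables (gT hT kT : finGroupType) (H : {group hT}).
Variables (U : {group gT}) (W : {group kT}) (gamma : epi U W).
Implicit Types s t : Gamma H gamma.

Lemma Galpha_Gbeta t w : w \in W -> Galpha t (Gbeta t w) = gamma w.
Proof. by case/and4P: (valP t) => _ _ _ /'forall_implyP tg /tg/eqP. Qed.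

Lemma Gbeta_H t w : w \in W -> Gbeta t w \in H.
Proof. by move=> Ww; apply: (subsetP (GV_sub t)); apply: epi_im. Qed.

(* The h such that h . t = s in the action Gact of H on triples. *)
Definition transporter s t : {set hT} :=
  [set h in H | [forall w in W, h * Gbeta t w == Gbeta s w * h]%g].

Lemma transporterP s t h :
  reflect (h \in H /\ {in W, forall w, h * Gbeta t w = Gbeta s w * h}%g)
          (h \in transporter s t).
Proof.
rewrite inE; apply: (iffP andP) => -[Hh eh]; split=> //.
  by move=> w Ww; apply/eqP/(forall_inP eh).
by apply/forall_inP=> w Ww; rewrite eh.
Qed.

(** Centralizing beta(W) is centralizing V, as beta is onto. *)
Lemma transporter_refl t : transporter t t = 'C_H(GV t)%g.
Proof.
apply/setP=> h; apply/transporterP/setIP => -[Hh ch]; split=> //.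
  by apply/centP=> _ /(epi_surj (Gbeta t))[w Ww ->]; apply: ch.
move=> w Ww; apply: (centP ch); exact: epi_im.
Qed.

(** [transporter] tests the third components only; as beta is onto, these determine V, and alpha is
    then forced by alpha beta = gamma. *)
Lemma transporter_Gact s t h : h \in transporter s t -> val t = Gact h^-1 (val s).
Proof.
case/transporterP=> Hh eh.
have eb w : w \in W -> Gbeta t w = (Gbeta s w ^ h)%g.
  by move=> Ww; rewrite conjgE -eh // mulKg.
have eV : GV t = (GV s :^ h)%G.
  apply/val_inj/setP=> v /=; apply/idP/imsetP.
    case/(epi_surj (Gbeta t))=> w Ww ->; exists (Gbeta s w); last exact: eb.
    exact: epi_im.
  case=> _ /(epi_surj (Gbeta s))[w Ww ->] ->; rewrite -eb //; exact: epi_im.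
rewrite [LHS]surjective_pairing [X in (X, _)]surjective_pairing /Gact.
congr (_, _, _).
- apply/ffunP=> v; rewrite ffunE; have [Vv | nVv] := boolP (v \in GV t).
    have [w Ww ->] := epi_surj (Gbeta t) Vv.
    rewrite {2}eb // conjgK; transitivity (gamma w); first exact: Galpha_Gbeta.
    by rewrite -[LHS](Galpha_Gbeta s).
  transitivity (1%g : gT); first exact: (epi_out (Galpha t)).
  apply/esym/(epi_out (Galpha s)); apply: contra nVv.
  by rewrite eV mem_conjg.
- by rewrite -/(GV t) eV; apply: val_inj; rewrite /= invgK.
- apply/ffunP=> w; rewrite ffunE invgK; have [Ww | nWw] := boolP (w \in W).
    exact: eb.
  transitivity (1%g : hT); first exact: (epi_out (Gbeta t)).
  by rewrite [X in (X ^ h)%g](epi_out (Gbeta s) nWw) conj1g.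
Qed.

Lemma Gact_transporter s t h : h \in H -> val t = Gact h (val s) ->
  h^-1%g \in transporter s t.
Proof.
move=> Hh et; apply/transporterP; split=> [|w Ww]; first by rewrite groupV.
have -> : Gbeta t w = (Gbeta s w ^ h^-1)%g.
  by rewrite /epi_fun /= et /= ffunE.
by rewrite -conjgC.
Qed.

Lemma transporter1 t : 1%g \in transporter t t.
Proof. by apply/transporterP; split=> // w _; rewrite mul1g mulg1. Qed.

Lemma Gorbit_transporter s t : (t \in Gorbit s) = (transporter s t != set0).
Proof.
rewrite inE; apply/exists_inP/set0Pn => [[h Hh /eqP e] | [h th]].
  by exists h^-1%g; apply: Gact_transporter.
exists h^-1%g; last exact/eqP/transporter_Gact.
by case/transporterP: th => Hh _; rewrite groupV.
Qed.

Lemma mem_Gorbits s : Gorbit s \in [set Gorbit t | t : Gamma H gamma].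
Proof. by apply/imsetP; exists s. Qed.

(** An element of the transporter would put [s] and [t] into one orbit, which a transversal meets
    only once. *)
Lemma Gorbit_reps_uniq (X : {set Gamma H gamma}) s t : Gorbit_reps X ->
  s \in X -> t \in X -> s != t -> transporter s t = set0.
Proof.
case/and3P=> _ _ /forall_inP oneX Xs Xt nst; apply/eqP/negPn/negP.
rewrite -Gorbit_transporter => st.
have /cards1P[r er] := oneX _ (mem_Gorbits s).
have ss : s \in Gorbit s.
  by rewrite Gorbit_transporter; apply/set0Pn; exists 1%g; apply: transporter1.
have : s \in X :&: Gorbit s by rewrite inE Xs.
have : t \in X :&: Gorbit s by rewrite inE Xt.
by rewrite !er !inE => /eqP et /eqP es; rewrite et es eqxx in nst.
Qed.

Lemma Gorbit_reps_exists (X : {set Gamma H gamma}) s : Gorbit_reps X ->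
  exists2 t, t \in X & exists h, h \in transporter s t.
Proof.
case/and3P=> _ _ /forall_inP oneX.
have /cards1P[t et] := oneX _ (mem_Gorbits s).
have /setIP[Xt st] : t \in X :&: Gorbit s by rewrite et set11.
by exists t => //; apply/set0Pn; rewrite -Gorbit_transporter.
Qed.

End GammaTheory.

(** * The canonical maps *)

Lemma ffix_lhdP (F : fieldType) (gT hT : finGroupType) (G : {group gT})
    (H : {group hT}) (M : bimodule F G H) (fr : frame M)
    (U : {group gT}) (V : {group hT}) (a : epi U V) x :
  reflect (x \in fdom fr /\ {in V, forall v, fto x (a v, v) = x}) (x \in ffix fr (lhd a)).
Proof.
apply: (iffP (@ffixP _ _ _ _ fr (lhd a) x)) => -[Dx fx]; split=> //.
  by move=> v Vv; apply: fx; apply: mem_lhd.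
by move=> _ /imsetP[v Vv ->]; apply: fx.
Qed.

Section CanonicalMaps.
Variables (F : fieldType) (p : nat) (charF : p \in [pchar F]).
Variables (gT hT kT : finGroupType).
Variables (G : {group gT}) (H : {group hT}) (K : {group kT}).
Variables (M : bimodule F G H) (N : bimodule F H K).
Variables (fr1 : frame M) (fr2 : frame N).
Hypotheses (free1 : left_free fr1) (free2 : left_free fr2).
Variables (U : {group gT}) (W : {group kT}).
Hypotheses (sUG : U \subset G) (sWK : W \subset K).
Hypotheses (pW : (p.-group W)%g).
Variable gamma : epi U W.
Implicit Types s t : Gamma H gamma.

Notation XY := (fpt fr1 * fpt fr2)%type.
Notation frT := (tens_frame fr1 free2).

Let sGK := lhd_sub gamma sUG sWK.
Let sGH t := lhd_sub (Galpha t) sUG (GV_sub t).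
Let sHK t := lhd_sub (Gbeta t) (GV_sub t) sWK.

Lemma gamma_G w : w \in W -> gamma w \in G.
Proof. by move=> Ww; apply: (subsetP sUG); apply: epi_im. Qed.

Definition Gfix t : {set XY} :=
  setX (ffix fr1 (lhd (Galpha t))) (ffix fr2 (lhd (Gbeta t))).

(** As V = beta(W) and alpha beta = gamma, the graph of alpha consists of the pairs (gamma w, beta
    w), so both conditions can be tested over [W]. *)
Lemma GfixP t (z : XY) :
  reflect [/\ z \in pair_dom fr1 fr2,
              {in W, forall w, fto z.1 (gamma w, Gbeta t w) = z.1}
            & {in W, forall w, fto z.2 (Gbeta t w, w) = z.2}]
          (z \in Gfix t).
Proof.
case: z => x y; apply: (iffP setXP) => /=.
  case=> /ffix_lhdP[Dx fx] /ffix_lhdP[Dy fy]; split=> //; first by apply/setXP.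
  by move=> w Ww; rewrite -(Galpha_Gbeta t Ww) fx // epi_im.
case=> /setXP[Dx Dy] fx fy; split; apply/ffix_lhdP; split=> //.
by move=> _ /(epi_surj (Gbeta t))[w Ww ->]; rewrite Galpha_Gbeta // fx.
Qed.

Lemma Gfix_dom t (z : XY) : z \in Gfix t -> z \in pair_dom fr1 fr2.
Proof. by case/GfixP. Qed.

Lemma pairM (aT bT : finGroupType) (a a' : aT) (b b' : bT) :
  ((a * a', b * b') = (a, b) * (a', b') :> aT * bT)%g.
Proof. by []. Qed.

Lemma in_pair (aT bT : finGroupType) (A : {group aT}) (B : {group bT}) a b :
  a \in A -> b \in B -> (a, b) \in setX_group A B.
Proof. by move=> Aa Bb; apply/setXP. Qed.

(** The relation h beta_t(w) = beta_s(w) h carries the elements of the groups of [s] across h into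
    those of the groups of [t]. *)
Lemma Gfix_transporter s t h (z : XY) :
  h \in transporter s t -> z \in Gfix s -> mid_to z h \in Gfix t.
Proof.
case/transporterP=> Hh eh /GfixP[Dz fx fy]; apply/GfixP; split.
- by rewrite mid_dom.
- move=> w Ww /=; have Hs := Gbeta_H s Ww; have Ht := Gbeta_H t Ww.
  rewrite -ftoM ?in_pair ?gamma_G // -pairM mul1g eh //.
  by rewrite -[X in (X, _)]mulg1 pairM ftoM ?in_pair ?gamma_G // fx.
- move=> w Ww /=; have Hs := Gbeta_H s Ww; have Ht := Gbeta_H t Ww.
  have Kw := subsetP sWK w Ww.
  rewrite -ftoM ?in_pair // -pairM mul1g eh //.
  by rewrite -[X in (_, X)]mulg1 pairM ftoM ?in_pair // fy.
Qed.

Section TwistedConjugation.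
Variables s t : Gamma H gamma.

(** A right action of [W] on [H]; its fixed points are the h with h beta_t = beta_s h, that is, the
    elements of [transporter s t]. *)
Definition twist (h : hT) (w : kT) := ((Gbeta s w)^-1 * h * Gbeta t w)%g.

Fact twist_is_action : is_action W twist.
Proof.
split=> [w h h' /mulIg/mulgI // | h w w' Ww Ww'].
by rewrite /twist !epiM // invMg !mulgA.
Qed.

Definition twist_action := Action twist_is_action.

Lemma twist_acts : [acts W, on H | twist_action].
Proof.
apply/subsetP=> w Ww; rewrite !inE Ww /=; apply/subsetP=> h Hh.
by rewrite inE /= !groupM ?groupV ?Gbeta_H.
Qed.

Lemma transporter_fix h :
  (h \in transporter s t) = (h \in H) && (h \in 'Fix_twist_action(W)).
Proof.
apply/transporterP/andP => -[Hh fh]; split=> //.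
  by apply/afixP=> w Ww /=; rewrite /twist -mulgA fh // mulKg.
move=> w Ww; have /afixP/(_ w Ww) /= fw := fh.
by rewrite -{2}fw /twist -mulgA mulKVg.
Qed.

(** Moving h by w under [twist] moves the two points by (gamma w, beta_t w) and (beta_t w, w), which
    fix [m] and [n]. The terms are thus constant on the orbits of the [p]-group [W], and only the
    fixed h survive. *)
Lemma theta_transporter (z : XY) m n : z \in Gfix s ->
  m \in fixv M (lhd (Galpha t)) -> n \in fixv N (lhd (Gbeta t)) ->
  theta z m n = \sum_(h in transporter s t)
    (fco (mid_to z h).1 m : F) *: (fco (mid_to z h).2 n : F^o).
Proof.
move=> Fz fm fn; have /GfixP[Dz fx fy] := Fz.
rewrite /theta (sum_pgroup_fixed charF pW twist_acts).
  by apply: eq_bigl => h; rewrite transporter_fix.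
move=> h Hh w Ww /=; have Hs := Gbeta_H s Ww; have Ht := Gbeta_H t Ww.
have Kw := subsetP sWK w Ww; have Gw := gamma_G Ww.
have [/= Dx Dy] := pair_domP (etrans (mid_dom z Hh) Dz).
have a1 : (gamma w, Gbeta t w) \in lhd (Galpha t).
  by rewrite -(Galpha_Gbeta t Ww) mem_lhd ?epi_im.
have a2 : (Gbeta t w, w) \in lhd (Gbeta t) by apply: mem_lhd.
rewrite -(fco_fix (sGH t) fm a1 Dx) -(fco_fix (sHK t) fn a2 Dy) /=.
(* Since [z] is fixed by the groups of [s], a factor beta_s(w) can be inserted, which cancels the
   left factor of [twist]. *)
have -> : fto z.1 (1%g, twist h w) = fto (fto z.1 (1%g, h)) (gamma w, Gbeta t w).
  rewrite -[RHS]ftoM ?in_pair // -pairM mul1g /twist.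
  rewrite -{1}(fx w Ww) -ftoM ?in_pair ?groupM ?groupV // -pairM mulg1.
  by rewrite !mulgA mulgV mul1g.
have -> : fto z.2 (twist h w, 1%g) = fto (fto z.2 (h, 1%g)) (Gbeta t w, w).
  rewrite -[RHS]ftoM ?in_pair // -pairM mul1g /twist.
  rewrite -{1}(fy w Ww) -ftoM ?in_pair ?groupM ?groupV // -pairM mulg1.
  by rewrite !mulgA mulgV mul1g.
by [].
Qed.

End TwistedConjugation.

(** By freeness, the stabilizers [S1] and [S2] of the two components meet G x 1 and H x 1 trivially,
    so each is the graph of a function of the second component: [S2] over [W] yields beta, and [S1]
    over V = beta(W) yields alpha. *)
Lemma Gamma_of_fixed (z : XY) : z \in pair_dom fr1 fr2 ->
  mid_orbit z \in ffix frT (lhd gamma) -> exists t, z \in Gfix t.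
Proof.
move=> Dz /ffix_lhdP[_ fz]; have [Dx Dy] := pair_domP Dz.
pose S1 := 'C_(setX_group G H)[z.1 | faction fr1]%G.
pose S2 := 'C_(setX_group H K)[z.2 | faction fr2]%G.
have S1P g : reflect (g \in setX_group G H /\ fto z.1 g = z.1) (g \in S1).
  apply: (iffP setIP) => -[Gg e]; split=> //.
    by move: e; rewrite (mem_astab1 (faction fr1)) // => /eqP.
  by rewrite (mem_astab1 (faction fr1)) //; apply/eqP.
have S2P g : reflect (g \in setX_group H K /\ fto z.2 g = z.2) (g \in S2).
  apply: (iffP setIP) => -[Gg e]; split=> //.
    by move: e; rewrite (mem_astab1 (faction fr2)) // => /eqP.
  by rewrite (mem_astab1 (faction fr2)) //; apply/eqP.
have inj1 g : (g, 1%g) \in S1 -> g = 1%g.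
  by case/S1P=> /setXP[Gg _]; apply: free1.
have inj2 h : (h, 1%g) \in S2 -> h = 1%g.
  by case/S2P=> /setXP[Hh _]; apply: free2.
have uniq2 h h' w : (h, w) \in S2 -> (h', w) \in S2 -> h = h'.
  move=> hS hS'; apply/eqP; rewrite eq_mulgV1; apply/eqP/inj2.
  rewrite -(mulgV w); exact: groupM hS (groupVr hS').
have uniq1 g g' h : (g, h) \in S1 -> (g', h) \in S1 -> g = g'.
  move=> hS hS'; apply/eqP; rewrite eq_mulgV1; apply/eqP/inj1.
  rewrite -(mulgV h); exact: groupM hS (groupVr hS').
(* As (gamma w, w) fixes the [H]-orbit of [z], it acts on [z] as some h in [H]; the value of beta at
   w is the inverse of h. *)
have exW : {in W, forall w, exists h, (gamma w, h) \in S1 /\ (h, w) \in S2}.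
  move=> w Ww; have Kw := subsetP sWK w Ww; have Gw := gamma_G Ww.
  have Xw : (gamma w, w) \in setX_group G K by apply: in_pair.
  have := mid_orbit_id (outer_to z (gamma w, w)).
  rewrite -tens_to_orbit // [tens_to _ _](fz w Ww).
  case/mid_orbitP=> h Hh [ex ey]; exists h^-1%g; split.
    apply/S1P; split; first by rewrite in_pair ?groupV.
    rewrite -[gamma w]mulg1 -[(h^-1)%g]mul1g pairM ftoM ?in_pair ?groupV // -ex.
    rewrite -ftoM ?in_pair ?groupV // -pairM mulgV mulg1; exact: fto1.
  apply/S2P; split; first by rewrite in_pair ?groupV.
  rewrite -[w]mulg1 -[(h^-1)%g]mul1g pairM ftoM ?in_pair ?groupV // -ey.
  rewrite -ftoM ?in_pair ?groupV // -pairM mulgV mulg1; exact: fto1.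
have [w Ww|b [bM b1 bS]] := @graph_hom _ _ S2 W inj2.
  by have [h [_]] := exW w Ww; exists h.
pose V := (morphm bM @* W)%G.
have eV : V = b @: W :> {set hT} by rewrite /= morphimEdom.
have bS1 : {in W, forall w, (gamma w, b w) \in S1}.
  by move=> w Ww; have [h [h1 h2]] := exW w Ww; rewrite (uniq2 _ _ _ (bS w Ww) h2).
have [v|a [aM a1 aS]] := @graph_hom _ _ S1 V inj1.
  by rewrite eV => /imsetP[w Ww ->]; exists (gamma w); apply: bS1.
have Vb w : w \in W -> b w \in V by move=> Ww; rewrite eV imset_f.
have ab w : w \in W -> a (b w) = gamma w.
  by move=> Ww; apply: uniq1 (aS _ (Vb w Ww)) (bS1 w Ww).
have isG : is_Gamma H gamma (a, V, b).
  apply/and4P; split=> /=.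
  - apply/subsetP=> v; rewrite eV => /imsetP[w Ww ->].
    by have /S2P[/setXP[]] := bS w Ww.
  - apply/and3P; split=> //.
      by apply/forall_inP=> v Vv; rewrite a1.
    apply/eqP/setP=> u; apply/imsetP/idP => [[v] | /(epi_surj gamma)[w Ww ->]].
      by rewrite eV => /imsetP[w Ww ->] ->; rewrite ab // epi_im.
    by exists (b w); rewrite ?Vb ?ab.
  - apply/and3P; split=> //; last by rewrite eV.
    by apply/forall_inP=> w Ww; rewrite b1.
  - by apply/'forall_implyP=> w Ww; rewrite ab.
exists (Sub (a, V, b) isG); apply/GfixP; split=> // w Ww.
  by have /S1P[] := bS1 w Ww.
by have /S2P[] := bS w Ww.
Qed.

Lemma mid_orbit_fixed t (z : XY) : z \in Gfix t -> mid_orbit z \in ffix frT (lhd gamma).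
Proof.
case/GfixP=> Dz fx fy; apply/ffix_lhdP; split; first exact: imset_f.
move=> w Ww; have Kw := subsetP sWK w Ww; have Gw := gamma_G Ww.
have Hb := Gbeta_H t Ww.
rewrite [LHS]tens_to_orbit ?in_pair //; apply: mid_orbit_eq.
apply/mid_orbitP; exists (Gbeta t w)^-1%g; rewrite ?groupV //.
rewrite /mid_to /outer_to /= -{1}(fx w Ww) -{1}(fy w Ww).
rewrite -!ftoM ?in_pair ?groupV //.
by congr (fto _ (_, _), fto _ (_, _)); rewrite ?mulgV ?mulg1.
Qed.

Let pG t : (p.-group (lhd (Galpha t)))%g.
Proof. by apply: lhd_pgroup; apply: epi_pgroup (Gbeta t) pW. Qed.

Let pH t : (p.-group (lhd (Gbeta t)))%g.
Proof. exact: lhd_pgroup. Qed.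

Let pGK : (p.-group (lhd gamma))%g.
Proof. exact: lhd_pgroup. Qed.

(** * The canonical map of one triple *)

Section Canonical.
Variable t : Gamma H gamma.

Notation P := (lhd (Galpha t)).
Notation Q := (lhd (Gbeta t)).
Notation R := (lhd gamma).

(** As gamma(w) m = m beta(w) and n w^-1 = beta(w)^-1 n, the two factors cancel across the tensor
    sign. *)
Lemma bpure_fixv (m : M) (n : N) : m \in fixv M P -> n \in fixv N Q ->
  bpure m n \in fixv (btens M N) R.
Proof.
move=> /fixvP fm /fixvP fn; apply/fixvP=> _ /imsetP[w Ww ->].
have Kw := subsetP sWK w Ww; have Gw := gamma_G Ww; have Hb := Gbeta_H t Ww.
rewrite btens_actE ?in_pair //=.
have a1 : (gamma w, Gbeta t w) \in P.
  by rewrite -(Galpha_Gbeta t Ww) mem_lhd ?epi_im.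
have a2 : (Gbeta t w, w) \in Q by apply: mem_lhd.
have -> : lmact M (gamma w) m = rmact M (Gbeta t w) m.
  by rewrite -{2}(fm _ a1) /rmact mactMv ?in_pair ?groupV // -pairM mul1g mulVg.
have -> : rmact N w^-1 n = lmact N (Gbeta t w)^-1 n.
  rewrite -{2}(fn _ a2) /lmact mactMv ?in_pair ?groupV // -pairM mul1g mulVg.
  by rewrite /rmact invgK.
rewrite bpure_balanced // /lmact mactMv ?in_pair ?groupV // -pairM mulgV mulg1.
by rewrite mact1 id_lfunE.
Qed.

(** This makes the canonical map well defined. Each coordinate of m (x) n at a fixed orbit is a sum
    over a transporter, whose elements move the pair to one fixed by the groups of [t]; there the
    coordinates of traces vanish. *)
Lemma brcls_bpure0 (m : M) (n : N) : m \in fixv M P -> n \in fixv N Q ->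
  m \in traces M P \/ n \in traces N Q -> brcls R (bpure m n) = 0.
Proof.
move=> fm fn tmn.
rewrite (brcls_frame sGK frT) ?bpure_fixv // big1 // => S FS.
have /ffixP[/imsetP[z Dz eS] _] := FS; rewrite eS in FS *.
have [s Fz] := Gamma_of_fixed Dz FS.
rewrite tens_coE // tcoE // (theta_transporter Fz fm fn) big1 ?scale0r // => h th.
have := Gfix_transporter th Fz; case/setXP=> F1 F2.
case: tmn => [tm | tn].
  by rewrite (fco_traces (sGH t) charF (pG t) tm F1) scale0r.
by rewrite (fco_traces (sHK t) charF (pH t) tn F2) scaler0.
Qed.

Notation MP := (brauer_lhd M (Galpha t) sUG (GV_sub t)).
Notation NQ := (brauer_lhd N (Gbeta t) (GV_sub t) sWK).
Notation MNR := (brauer_lhd (btens M N) gamma sUG sWK).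

Definition mcls (m : M) : MP := brauer_lhd_cls (Galpha t) sUG (GV_sub t) m.
Definition ncls (n : N) : NQ := brauer_lhd_cls (Gbeta t) (GV_sub t) sWK n.
Definition mncls (u : btens M N) : MNR := brauer_lhd_cls gamma sUG sWK u.

(** Chosen representatives make bilinearity immediate; independence of the choice is
    [can_bil_cls]. *)
Definition can_bil (m : MP) (n : NQ) : MNR :=
  mncls (bpure (sqrepr (fixv M P) (traces M P) m) (sqrepr (fixv N Q) (traces N Q) n)).

Lemma can_bilinear : bilinear_fun can_bil.
Proof.
split=> [n c m m' | m c n n']; rewrite /can_bil.
  by rewrite (linearP (sqrepr _ _)) bpure_linearl; apply: linearP.
by rewrite (linearP (sqrepr _ _)) bpure_linearr; apply: linearP.
Qed.

Lemma can_bil_cls (m : M) (n : N) : m \in fixv M P -> n \in fixv N Q ->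
  can_bil (mcls m) (ncls n) = mncls (bpure m n).
Proof.
move=> fm fn; rewrite /can_bil.
set m' := sqrepr _ _ _; set n' := sqrepr _ _ _.
have fm' : m' \in fixv M P by apply: sqreprP.
have fn' : n' \in fixv N Q by apply: sqreprP.
have dm : m' - m \in traces M P by apply: sqpi_reprB.
have dn : n' - n \in traces N Q by apply: sqpi_reprB.
have e1 : mncls (bpure (m' - m) n') = 0.
  by apply: brcls_bpure0 (memvB fm' fm) fn' (or_introl dm).
have e2 : mncls (bpure m (n' - n)) = 0.
  by apply: brcls_bpure0 fm (memvB fn' fn) (or_intror dn).
transitivity (mncls (bpure m n')); apply/eqP; rewrite -subr_eq0; apply/eqP.
  by rewrite -e1 (lin_sub _ _ (bpure_linearl n')) [RHS]linearB.
by rewrite -e2 (lin_sub _ _ (bpure_linearr m)) [RHS]linearB.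
Qed.

Lemma mcls_repr (x : MP) : exists2 m, m \in fixv M P & x = mcls m.
Proof. by exists (sqrepr _ _ x); [apply: sqreprP | apply: brcls_repr]. Qed.

Lemma ncls_repr (x : NQ) : exists2 n, n \in fixv N Q & x = ncls n.
Proof. by exists (sqrepr _ _ x); [apply: sqreprP | apply: brcls_repr]. Qed.

Lemma mcls_act g m : g \in setX_group 'C_G(U)%G 'C_H(GV t)%G -> m \in fixv M P ->
  mact M g m \in fixv M P /\ mact MP g (mcls m) = mcls (mact M g m).
Proof.
move/(subsetP (cent_lhd_norm (Galpha t) _ _)) => Ng fm.
by split; [apply: (fixv_mact (sGH t)) | apply: brauer_actE].
Qed.

Lemma ncls_act g n : g \in setX_group 'C_H(GV t)%G 'C_K(W)%G -> n \in fixv N Q ->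
  mact N g n \in fixv N Q /\ mact NQ g (ncls n) = ncls (mact N g n).
Proof.
move/(subsetP (cent_lhd_norm (Gbeta t) _ _)) => Ng fn.
by split; [apply: (fixv_mact (sHK t)) | apply: brauer_actE].
Qed.

Lemma mncls_act g u : g \in setX_group 'C_G(U)%G 'C_K(W)%G -> u \in fixv (btens M N) R ->
  mact MNR g (mncls u) = mncls (mact (btens M N) g u).
Proof. by move/(subsetP (cent_lhd_norm gamma _ _)) => Ng fu; apply: brauer_actE. Qed.

Lemma can_balanced : {in 'C_H(GV t)%G, forall c m n,
  can_bil (rmact MP c m) n = can_bil m (lmact NQ c n)}.
Proof.
move=> c Cc m' n'; have [m fm ->] := mcls_repr m'; have [n fn ->] := ncls_repr n'.
have Hc : c \in H by case/setIP: Cc.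
have [] := @mcls_act (1%g, c^-1)%g m _ fm; first by rewrite in_pair ?groupV.
rewrite /rmact => fcm ->.
have [] := @ncls_act (c, 1%g) n _ fn; first by rewrite in_pair.
rewrite /lmact => fcn ->.
by rewrite !can_bil_cls //; congr mncls; apply: bpure_balanced.
Qed.

Definition can : 'Hom(Gamma_tensor M N sUG sWK t, MNR) := btens_lift can_bil.

Lemma can_cls (m : M) (n : N) : m \in fixv M P -> n \in fixv N Q ->
  can (bpure (mcls m) (ncls n)) = mncls (bpure m n).
Proof.
move=> fm fn; rewrite -can_bil_cls //.
by apply: btens_liftE; [apply: can_bilinear | apply: can_balanced].
Qed.

Lemma can_eq (V : vectType F) (f g : Gamma_tensor M N sUG sWK t -> V) :
  linear f -> linear g ->
  (forall m n, m \in fixv M P -> n \in fixv N Q ->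
     f (bpure (mcls m) (ncls n)) = g (bpure (mcls m) (ncls n))) -> f =1 g.
Proof.
move=> lf lg fg; apply: btens_eq => // m' n'.
by have [m fm ->] := mcls_repr m'; have [n fn ->] := ncls_repr n'; apply: fg.
Qed.

Lemma can_hom : gmod_hom can.
Proof.
move=> g Cg; apply: can_eq => [c u v | c u v | m n fm fn]; rewrite ?linearP //.
have [Cg1 Cg2] : g.1 \in 'C_G(U)%G /\ g.2 \in 'C_K(W)%G.
  by case: g Cg => g1 g2 /setXP.
rewrite [X in can X]btens_actE // can_cls // mncls_act ?bpure_fixv //.
have [] := @mcls_act (g.1, 1%g) m _ fm; first by rewrite in_pair.
rewrite /lmact => fgm ->.
have [] := @ncls_act (1%g, g.2^-1^-1)%g n _ fn; first by rewrite in_pair ?invgK.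
rewrite /rmact => fgn ->.
rewrite can_cls //; congr mncls; rewrite btens_actE //.
case: g Cg {Cg1 Cg2 fgm fgn} => g1 g2 /setXP[/setIP[Gg _] /setIP[Kg _]].
exact: in_pair.
Qed.

Definition mframe : frame MP :=
  res_frame (cent_lhd_norm (Galpha t) G H) (brauer_frame charF (sGH t) (pG t) fr1).

Definition nframe : frame NQ :=
  res_frame (cent_lhd_norm (Gbeta t) H K) (brauer_frame charF (sHK t) (pH t) fr2).

(** C_H(V) x 1 inherits freeness from H x 1; this gives the tensor product over F[C_H(V)] a frame of
    its own. *)
Lemma nframe_free : left_free nframe.
Proof.
move=> h y /setIP[Hh _] Fy e.
have /ffixP[Dy _] : y \in ffix fr2 (lhd (Gbeta t)) := Fy.
exact: (free2 Hh Dy).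
Qed.

Definition mn_co (S : {set XY}) : 'Hom(MNR, F^o) :=
  brauer_co sGK (fr := frT) S.

(** No term survives in [theta_transporter]: triples in different orbits do not interact. *)
Lemma can_co0 s (z : XY) u : z \in Gfix s -> transporter s t = set0 ->
  mn_co (mid_orbit z) (can u) = 0.
Proof.
move=> Fz st0; have Dz := Gfix_dom Fz; have FS := mid_orbit_fixed Fz.
move: u; apply: (can_eq (g := fun=> 0)) => [c u v | c u v | m n fm fn].
- by rewrite !linearP.
- by rewrite scaler0 addr0.
rewrite can_cls // [LHS](brauer_co_cls charF sGK pGK) ?bpure_fixv //.
by rewrite tens_coE // tcoE // (theta_transporter Fz fm fn) st0 big_set0.
Qed.

(** The surviving h form C_H(V), and the coordinates of [m] and [n] at fixed points are those of
    their classes, so the sum is the coordinate formula of the tensor product over F[C_H(V)]. *)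
Lemma can_co1 (z : XY) u : z \in Gfix t ->
  mn_co (mid_orbit z) (can u) = tco (fr1 := mframe) (fr2 := nframe) z u.
Proof.
move=> Fz; have Dz := Gfix_dom Fz; have FS := mid_orbit_fixed Fz.
move: u; apply: can_eq => [c u v | c u v | m n fm fn]; first by rewrite !linearP.
  by rewrite linearP.
rewrite can_cls // [LHS](brauer_co_cls charF sGK pGK) ?bpure_fixv //.
rewrite tens_coE // tcoE // (theta_transporter Fz fm fn) transporter_refl.
rewrite tcoE //; apply: eq_bigr => h Ch.
have th : h \in transporter t t by rewrite transporter_refl.
have := Gfix_transporter th Fz; case/setXP=> F1 F2.
rewrite [fco (f := mframe) _ _](brauer_co_cls charF (sGH t) (pG t) F1 fm).
by rewrite [fco (f := nframe) _ _](brauer_co_cls charF (sHK t) (pH t) F2 fn).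
Qed.

End Canonical.

(** * The direct sum over orbit representatives *)

Variables (X : {set Gamma H gamma}) (repX : Gorbit_reps X).

Notation T := (fun t : {t : Gamma H gamma | t \in X} =>
  Gamma_tensor M N sUG sWK (val t)).
Notation MNR := (brauer_lhd (btens M N) gamma sUG sWK).

Definition can_sum_fun (u : gdsum T) : MNR := \sum_t can (val t) (u t).

Fact can_sum_linear : linear can_sum_fun.
Proof.
move=> c u v; rewrite /can_sum_fun scaler_sumr -big_split; apply: eq_bigr => t _.
by rewrite !ffunE linearP.
Qed.

Definition can_sum : 'Hom(gdsum T, MNR) := linfun can_sum_fun.

Lemma can_sumE u : can_sum u = \sum_t can (val t) (u t).
Proof. exact: (linfunK can_sum_linear). Qed.

Lemma can_sum_inj_cls (t : {t : Gamma H gamma | t \in X}) (u : T t) :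
  can_sum (gdsum_inj T t u) = can (val t) u.
Proof.
rewrite can_sumE (bigD1 t) //= ffunE dfwith_in big1 ?addr0 // => s nst.
by rewrite ffunE dfwith_out ?linear0 // eq_sym.
Qed.

Lemma can_sum_hom : gmod_hom can_sum.
Proof.
move=> g Cg u; rewrite !can_sumE [RHS]linear_sum; apply: eq_bigr => t _.
by rewrite [mact (gdsum T) g u]lfunE ffunE; apply: can_hom.
Qed.

(** The coordinates at the orbits of pairs in [Gfix t] see only the summand of [t], by [can_co0],
    and determine it, by [can_co1] and [tco_inj]. *)
Lemma can_sum_injective : injective can_sum.
Proof.
apply/lker0P; rewrite -subv0; apply/subvP=> u; rewrite memv_ker memv0 => /eqP u0.
apply/eqP/ffunP=> t; rewrite [RHS]ffunE.
(* The domain of pairs for [mframe] and [nframe] is convertible to [Gfix (val t)]. *)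
apply: (tco_inj (fr1 := mframe (val t)) (@nframe_free (val t))) => z Fz.
rewrite -[LHS](can_co1 (t := val t) (z := z) (u t) Fz).
have Fz' : (z : XY) \in Gfix (val t) := Fz.
rewrite -[RHS](linear0 (mn_co (mid_orbit (z : XY)))) -u0 can_sumE.
rewrite [RHS]linear_sum (bigD1 t) //= big1 => [|s nst]; first by rewrite addr0.
apply: can_co0 Fz' _; apply: Gorbit_reps_uniq repX (valP t) (valP s) _.
by rewrite (inj_eq val_inj) eq_sym.
Qed.

(** The classes of the frame vectors at fixed orbits span the target. Each such orbit contains a
    pair fixed by the groups of a chosen representative, and its vector is then the image of a pure
    tensor of classes. *)
Lemma can_sum_surj (v : MNR) : exists u, can_sum u = v.
Proof.
suff: v \in limg can_sum by case/memv_imgP=> u _ ->; exists u.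
have fv : sqrepr _ _ v \in fixv (btens M N) (lhd gamma) by apply: sqreprP.
rewrite [v](brcls_repr (sPG := sGK)) (brcls_frame sGK frT fv).
apply: memv_suml => S FS; apply: memvZ.
have /ffixP[/imsetP[z Dz eS] _] := FS; rewrite eS in FS *.
have [s Fs] := Gamma_of_fixed Dz FS.
have [t Xt [h th]] := Gorbit_reps_exists s repX.
have Hh : h \in H by case/transporterP: th.
have := Gfix_transporter th Fs; case/setXP=> F1 F2.
have -> : fvec (f := frT) (mid_orbit z) = pvec z by apply: tens_vecE.
(* [z] is moved inside its [H]-orbit to a pair in [Gfix t], whose two vectors are fixed by the
   groups of [t]. *)
rewrite -(pvec_mid Dz Hh) /pvec.
rewrite -[brcls _ _](can_cls (t := t)) ?(fixv_fvec (sGH t)) ?(fixv_fvec (sHK t)) //.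
pose t' : {t : Gamma H gamma | t \in X} := Sub t Xt.
by rewrite -[can t _](@can_sum_inj_cls t') memv_img ?memvf.
Qed.

End CanonicalMaps.

Theorem theorem3p2 (F : fieldType) (p : nat) (charF : p \in [pchar F]%R)
    (gT hT kT : finGroupType) (G : {group gT}) (H : {group hT}) (K : {group kT})
    (M : bimodule F G H) (N : bimodule F H K)
    (ppM : p_permutation M) (ppN : p_permutation N)
    (vertM : forall L : bimodule F G H, indecomposable L -> isom_to_summand L M ->
       forall P : {group gT * hT}, vertex L P -> in_lhd G H P)
    (vertN : forall L : bimodule F H K, indecomposable L -> isom_to_summand L N ->
       forall P : {group hT * kT}, vertex L P -> in_lhd H K P)
    (U : {group gT}) (W : {group kT}) (sUG : U \subset G) (sWK : W \subset K)
    (pU : (p.-group U)%g) (pW : (p.-group W)%g) (gamma : epi U W)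
    (X : {set Gamma H gamma}) (repX : Gorbit_reps X) :
  let T := fun t : {t : Gamma H gamma | t \in X} =>
    Gamma_tensor M N sUG sWK (val t) in
  exists Phi : 'Hom(gdsum T, brauer_lhd (btens M N) gamma sUG sWK),
    [/\ gmod_hom Phi,
        bijective Phi
      & forall (t : {t : Gamma H gamma | t \in X}) (m : M) (n : N),
          m \in fixv M (lhd (Galpha (val t))) ->
          n \in fixv N (lhd (Gbeta (val t))) ->
          Phi (gdsum_inj T t
                 (bpure (brauer_lhd_cls (Galpha (val t)) sUG (GV_sub (val t)) m)
                        (brauer_lhd_cls (Gbeta (val t)) (GV_sub (val t)) sWK n)))
          = brauer_lhd_cls gamma sUG sWK (bpure m n)].
Proof.
have [fr1 free1] := left_free_frame ppM vertM.
have [fr2 free2] := left_free_frame ppN vertN.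
move=> T; exists (can_sum M N sUG sWK X); split.
- exact: (can_sum_hom charF free1 free2 pW).
- pose Phi := can_sum M N sUG sWK X.
  have inj : injective Phi := can_sum_injective charF free1 free2 pW repX.
  have surj : forall v, exists u, Phi u = v := can_sum_surj charF free1 free2 pW repX.
  have fullPhi : limg Phi = fullv.
    apply/eqP; rewrite eqEsubv subvf; apply/subvP=> v _.
    by have [u <-] := surj v; rewrite memv_img ?memvf.
  have ker0 : lker Phi == 0%VS by apply/lker0P.
  exists (Phi^-1)%VF => [u | v]; first exact: lker0_lfunK.
  by rewrite limg_lfunVK // fullPhi memvf.
- move=> t m n fm fn; rewrite can_sum_inj_cls.
  exact: (can_cls charF free1 free2 sUG sWK pW).
Qed.
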